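(* Let $\rho\in[0,1)$ and let $(X,Y)$ be a standard bivariate elliptical random vector with Pearson correlation coefficient $\rho$ and radial distribution function $H$. Let $\bar H=1-H$. Assume that $H$ is rapidly varying and that there are functions $\psi>0$, $\chi$ and $\Theta$ such that $$\left|\frac{\bar H\{x+t\psi(x)\}}{\bar H(x)}-e^{-t}\right|\le \chi(x)\,\Theta(t)\qquad\text{for all } t\ge 0 \text{ and all } x \text{ large enough},$$ where $\lim_{x\to\infty}\chi(x)=0$, $\lim_{x\to\infty}\psi(x)/x=0$, and $\Theta$ is locally bounded and integrable over $[0,\infty)$. Then, for all $z\in\mathbb R$, as $x\to\infty$, $$\mathbb P\bigl(Y\le \rho x+z\sqrt{1-\rho^2}\sqrt{x\psi(x)}\;\big|\;X>x\bigr)=\Phi(z)-\sqrt{\frac{\psi(x)}{x}}\,\frac{\rho\,\varphi(z)}{\sqrt{1-\rho^2}}+O\left(\chi(x)+\frac{\psi(x)}{x}\right),$$ $$\mathbb P\bigl(Y\le \rho x+z\sqrt{1-\rho^2}\sqrt{x\psi(x)}+\rho\,\psi(x)\;\big|\;X>x\bigr)=\Phi(z)+O\left(\chi(x)+\frac{\psi(x)}{x}\right),$$ and all the $O(\cdot)$ terms are locally uniform with respect to $z$ (i.e. uniform for $z$ in compact subsets of $\mathbb R$).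
   Context: A standard bivariate elliptical vector with Pearson correlation coefficient $\rho$ (with $|\rho|<1$) and radial distribution function $H$ is a random vector that can be expressed as $$(X,Y)=R\,(\cos U,\ \rho\cos U+\sqrt{1-\rho^2}\,\sin U),$$ where $R$ and $U$ are independent, $R$ is a positive random variable with distribution function $H$ and $\mathbb E R^2=2$, and $U$ is uniformly distributed on $[-\pi/2,3\pi/2]$ (so $\mathbb EX=\mathbb EY=0$ and $\operatorname{Var}X=\operatorname{Var}Y=1$). $H$ rapidly varying means that its upper tail $\bar H=1-H$ is rapidly varying at infinity: $\bar H(x)>0$ for all $x$ and $\bar H(\lambda x)/\bar H(x)\to 0$ as $x\to\infty$ for every $\lambda>1$. $\varphi(t)=e^{-t^2/2}/\sqrt{2\pi}$ is the standard normal density and $\Phi(x)=\int_{-\infty}^x\varphi(t)\,dt$ is the standard normal distribution function. *)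

(* Defs.v *)
From HB Require Import structures.
From mathcomp Require Import all_boot all_order all_algebra.
From mathcomp Require Import all_classical all_reals all_analysis.

Set Implicit Arguments.
Unset Strict Implicit.
Unset Printing Implicit Defensive.

Import Order.TTheory GRing.Theory Num.Theory.
Import numFieldNormedType.Exports.

Local Open Scope classical_set_scope.
Local Open Scope ring_scope.

Section Elliptical.
Context {R : realType} {d : measure_display} {T : measurableType d}.
Implicit Type P : probability T R.

Definition independent_RV P (V W : {RV P >-> R}) : Prop :=
  forall A B : set R, measurable A -> measurable B ->
    (P (V @^-1` A `&` W @^-1` B) = P (V @^-1` A) * P (W @^-1` B))%E.

Lemma angle_interval_lt : - (pi / 2) < 3 * pi / 2 :> R.
Proof.
have pi0 : 0 < pi :> R := pi_gt0 R.
apply: (@lt_trans _ _ 0); first by rewrite oppr_lt0 divr_gt0.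
by rewrite divr_gt0 // mulr_gt0.
Qed.

(* The law of [U] is prescribed on measurable sets only, because [uniform_prob]
   is a bare set function, also defined on non-measurable sets. *)
Definition uniform_angle P (U : {RV P >-> R}) : Prop :=
  forall A : set R, measurable A ->
    distribution P U A = uniform_prob angle_interval_lt A.

(* Positivity of [Rad] and the representation of [(X, Y)] hold almost surely.
   Asking for [Rad] and [U] on the sample space of [(X, Y)] loses nothing
   compared with equality in law: as [Rad > 0] and [`|rho| < 1], they are
   almost surely the polar coordinates of
   [(X, (Y - rho * X) / Num.sqrt (1 - rho ^+ 2))]. *)
Definition standard_elliptical P (X Y : {RV P >-> R}) (rho : R) (H : R -> R)
    : Prop :=
  `|rho| < 1 /\
  exists Rad U : {RV P >-> R},
    [/\ independent_RV Rad U,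
        [/\ {ae P, forall w, 0 < Rad w},
            forall r, cdf Rad r = (H r)%:E &
            ('E_P[fun w => (Rad w ^+ 2)%R] = 2%:E)%E],
        uniform_angle U,
        {ae P, forall w, X w = Rad w * cos (U w)} &
        {ae P, forall w, Y w =
          Rad w * (rho * cos (U w) + Num.sqrt (1 - rho ^+ 2) * sin (U w))}].

Definition cond_prob P (A B : set T) : R := fine (P (A `&` B)) / fine (P B).

End Elliptical.

Section RealFunctions.
Context {R : realType}.

Definition survival (H : R -> R) (x : R) : R := 1 - H x.

Definition rapidly_varying_tail (G : R -> R) : Prop :=
  (forall x, 0 < G x) /\
  forall lambda : R, 1 < lambda -> G (lambda * x) / G x @[x --> +oo] --> 0.

Definition phi (t : R) : R := normal_pdf 0 1 t.

Definition Phi (z : R) : R := fine (normal_prob (0 : R) 1 `]-oo, z]).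

Lemma phiE (t : R) : phi t = expR (- (t ^+ 2 / 2)) / Num.sqrt (2 * pi).
Proof.
rewrite /phi normal_pdfE ?oner_eq0 // /normal_peak /normal_fun.
by rewrite !expr1n subr0 mul1r mulNr mulrC -(mulr_natl pi 2).
Qed.

(* [f z x = O(e x)] as [x --> +oo], uniformly for [z] in compact sets. *)
Definition bigO_locally_uniform (f : R -> R -> R) (e : R -> R) : Prop :=
  forall K : set R, compact K ->
    exists C : R, \forall x \near +oo, forall z, K z ->
      `|f z x| <= C * `|e x|.

(* No sign is imposed on [chi], so it enters the error rate through its absolute
   value: for [chi] of negative sign [chi x + psi x / x] might vanish. *)
Definition error_rate (chi psi : R -> R) (x : R) : R :=
  `|chi x| + psi x / x.

End RealFunctions.

(* Main.v *)
Require Import Defs.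
From HB Require Import structures.
From mathcomp Require Import all_boot all_order all_algebra.
From mathcomp Require Import all_classical all_reals all_analysis.
From mathcomp Require Import measurable_realfun.
From mathcomp Require Import ring lra.

(** Write G for the survival function of the radius, sg = sqrt (1 - rho^2),
    h = sqrt (psi x / x), eta = rho + sg * h * z and y = x * eta, so that the
    first probability is P (Y <= y | X > x).

    Geometry.  Let cos theta = rho.  On the circle of radius r the event
    X > x, Y <= y is made of the angles u with r cos u > x and
    r cos (u - theta) <= y.  Let cos a = x / r and cos b = y / r.  Beyond the
    corner (x, y) these angles form the arc from -a to theta - b; for smaller r
    they form the full arc |u| < a or, when z < 0, no arc at all until the
    circle reaches the corner.  So its length is made of an integral along the ray
    X = x, Y <= y, which measures the angle from -a up to the corner, minus an
    integral along the half-line Y = y, X >= x, which measures the growth of b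
    beyond the corner ([arc_length_decomposition]).  On the ray, the angle u is replaced by the
    coordinate q with 1 / cos u = 1 + (h q)^2 / 2: then the radius x / cos u
    equals x + psi x * q^2 / 2, which is the scale of the hypothesis on G, and
    u is a smooth function of h q, of derivative 1 + O((h q)^2).

    Exact formula.  Averaging over the radius by Tonelli's theorem turns these
    lengths into integrals of G, and dividing by G x gives ([cond_prob_formula]), with g t = G (x + t psi x) / G x,

      P (Y <= y | X > x) = (I (-oo, q0] - h * eta * J) / I (-oo, +oo),

    where I integrates (1 + O(h^2 q^2)) g (q^2 / 2) and J integrates a bounded
    kernel against g over s >= q0^2 / 2.  The coordinate q0 of the corner is
    z + O(h^2).

    Asymptotics.  Replacing g t by exp (- t) costs O(chi): Theta is integrable,
    and so is Theta (q^2 / 2), by local boundedness for q near 0 and by a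
    change of variables elsewhere ([integrable_comp_halfsq]).  The integrand
    of I becomes exp (- q^2 / 2) up to a relative error O(h^2 q^2), so that
    I (-oo, q0] is sqrt (2 pi) Phi z + O(h^2 + chi).  There is no term of
    order h here: the coordinate q removes it.  The second integral eta * J is
    (rho / sg) exp (- z^2 / 2) + O(h + chi), and it enters multiplied by h,
    which gives the correction - h rho phi z / sg and a total error
    O(h^2 + chi) ([uniform_expansion]).

    Adding rho * psi x to the threshold amounts to replacing z by
    z + (rho / sg) h, which cancels the correction up to O(h^2) by a Taylor
    expansion of Phi ([shifted_expansion]). *)

Set Implicit Arguments.
Unset Strict Implicit.
Unset Printing Implicit Defensive.

Import Order.TTheory GRing.Theory Num.Theory.
Import numFieldNormedType.Exports.

Local Open Scope classical_set_scope.
Local Open Scope ring_scope.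

(** * Integrability of functions of a half square *)

Section expanding.
Context {R : realType}.
Local Notation mu := (@lebesgue_measure R).

(** Lebesgue measure is the infimum of the sums of lengths over countable covers
    by such intervals, and [nu] is countably subadditive. *)
Lemma le_lebesgue_of_ocitv (k : R) (k0 : 0 < k)
    (nu : {measure set (measurableTypeR R) -> \bar R}) :
  (forall a b : R, a < b -> (nu `]a, b]%classic <= (k * (b - a))%:E)%E) ->
  forall A, measurable A -> (nu A <= k%:E * mu A)%E.
Proof.
move=> nuk A mA.
rewrite -lee_pdivrMl//.
apply: le_ereal_inf_tmp => _ [M [mM AM] <-].
have mMk i : measurable (M i : set (measurableTypeR R)).
  by apply: sub_sigma_algebra; exact: mM.
rewrite lee_pdivrMl// -nneseriesZl//.
apply: (@le_trans _ _ (\sum_(i <oo) nu (M i))%E).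
  exact: measure_sigma_subadditive.
apply: lee_nneseries => // i _.
have /ocitvP[->|[[a b] /= ab ->]] := mM i.
  by rewrite !measure0 mule0.
by rewrite wlength_itv/= lte_fin ab -EFinB -EFinM nuk.
Qed.

(** The preimage under [F] of an interval of length l has diameter at most l / k,
    so the push-forward of Lebesgue measure by [F] is at most 2 / k times Lebesgue
    measure.  The factor 2 comes from enclosing the preimage in an interval
    centred at one of its points; any constant would do. *)
Lemma ge0_integral_comp_expanding (k : R) (k0 : 0 < k) (F : R -> R)
    (f : R -> \bar R) :
  measurable_fun [set: R] F ->
  (forall p q, p <= q -> k * (q - p) <= F q - F p) ->
  measurable_fun [set: R] f -> (forall x, 0 <= f x)%E ->
  (\int[mu]_q f (F q) <= (2 / k)%:E * \int[mu]_t f t)%E.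
Proof.
move=> mF exF mf f0.
pose Fm := isMeasurableFun.Build _ _ (measurableTypeR R) (measurableTypeR R) F mF.
pose G : {mfun measurableTypeR R >-> measurableTypeR R} := HB.pack F Fm.
have -> : (\int[mu]_q f (F q) = \int[pushforward mu G]_t f t)%E.
  by rewrite ge0_integral_pushforward//= preimage_setT.
have k2 : 0 <= 2 / k by rewrite divr_ge0// ltW.
rewrite -(ge0_integral_mscale _ _ (NngNum k2))//.
apply: (@ge0_le_measure_integral _ _ R (pushforward mu G) (mscale (NngNum k2) mu)) => // A mA.
apply: (@le_lebesgue_of_ocitv (2 / k)) => //; first by rewrite divr_gt0.
move=> a b ab.
rewrite -[X in (X <= _)%E]/(mu (F @^-1` `]a, b]%classic)).
have mpre : measurable (F @^-1` `]a, b]%classic).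
  by rewrite -(setTI (F @^-1` _)); exact: (measurable_funP G).
have [->|/set0P[p /= pab]] := eqVneq (F @^-1` `]a, b]%classic) set0.
  by rewrite measure0 lee_fin mulr_ge0// subr_ge0 ltW.
have sub : F @^-1` `]a, b] `<=` `[p - (b - a) / k, p + (b - a) / k].
  move=> q /=; move: pab; rewrite !in_itv/= => /andP[ap pb] /andP[aq qb].
  have d0 : 0 <= (b - a) / k by rewrite divr_ge0 ?subr_ge0// ltW.
  have [pq|/ltW qp] := leP p q.
    have : q - p <= (b - a) / k.
      by rewrite ler_pdivlMr// mulrC; have := exF _ _ pq; lra.
    by move=> H; apply/andP; split; lra.
  have : p - q <= (b - a) / k.
    by rewrite ler_pdivlMr// mulrC; have := exF _ _ qp; lra.
  by move=> H; apply/andP; split; lra.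
apply: (@le_trans _ _ (mu `[p - (b - a) / k, p + (b - a) / k])).
  by rewrite le_measure ?inE//=.
rewrite lebesgue_measure_itv/= lte_fin; case: ifPn => _.
  by rewrite -EFinB lee_fin; lra.
by rewrite lee_fin mulr_ge0// subr_ge0 ltW.
Qed.
End expanding.

Section halfsq.
Context {R : realType}.
Local Notation mu := (@lebesgue_measure R).

Lemma integral_even_le (f : R -> \bar R) :
  measurable_fun [set: R] f -> (forall x, 0 <= f x)%E ->
  (forall x, f (- x) = f x) ->
  (\int[mu]_x f x <= 2%:E * \int[mu]_(x in `[0%R, +oo[) f x)%E.
Proof.
move=> mf f0 fN.
rewrite -(setUv `[0, +oo[%classic).
rewrite ge0_integral_setU//=; first last.
- by rewrite disj_set2E setICr.
- by rewrite setUv.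
- exact: measurableC.
rewrite (_ : 2%:E = 1 + 1)%E// ge0_muleDl// mul1e leeD2l//.
rewrite ge0_integration_by_substitution0//.
under [leRHS]eq_integral do rewrite fN.
apply: ge0_subset_integral => //=; first exact: measurableC.
  exact: measurable_funTS.
by move=> x /=; rewrite !in_itv/= andbT => /negP; rewrite -ltNge => /ltW.
Qed.

(** The map q |-> q^2 / 2 is expanding only away from 0, and there the integral
    of [f] bounds the integral of its composition; near 0 the bound [M] is used.
    Replacing one factor q by [Num.max q c] makes the map expanding on the whole
    line without changing it for q >= c. *)
Lemma integral_comp_halfsq_lty (f : R -> R) (M delta : R) :
  0 < delta -> (forall t, 0 <= t -> t <= delta -> `|f t| <= M) ->
  mu.-integrable `[0, +oo[ (EFin \o f) ->
  (\int[mu]_q `|f (q ^+ 2 / 2)%R|%:E < +oo)%E.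
Proof.
move=> d0 fM /integrableP[mf fi].
pose c := Num.sqrt (2 * delta).
have c0 : 0 < c by rewrite sqrtr_gt0 mulr_gt0.
have cE : c ^+ 2 = 2 * delta by rewrite sqr_sqrtr// mulr_ge0// ltW.
pose g : R -> \bar R := (fun t : R => `|f t|%:E) \_ `[0, +oo[%classic.
have mg : measurable_fun [set: R] g.
  apply/(measurable_restrictT (fun t : R => `|f t|%:E)) => //.
  apply/measurable_EFinP.
  by apply: measurableT_comp => //; exact/measurable_EFinP.
have g0 t : (0 <= g t)%E by rewrite /g patchE; case: ifPn.
have gE t : 0 <= t -> g t = `|f t|%:E.
  by move=> t0; rewrite /g patchE mem_set//= in_itv/= t0.
have msq : measurable_fun [set: R] (fun q : R => q ^+ 2 / 2).
  by apply: measurable_funM => //; exact: measurable_funX.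
have sq0 (q : R) : 0 <= q ^+ 2 / 2 by rewrite divr_ge0 ?sqr_ge0.
have -> : (\int[mu]_q `|f (q ^+ 2 / 2)%R|%:E = \int[mu]_q g (q ^+ 2 / 2)%R)%E.
  by apply: eq_integral => q _; rewrite gE.
have mgs : measurable_fun [set: R] (fun q : R => g (q ^+ 2 / 2)).
  exact: measurableT_comp.
apply: le_lt_trans (integral_even_le mgs _ _) _ => //.
  by move=> x; rewrite sqrrN.
apply: lte_mul_pinfty => //.
pose F (q : R) := q * Num.max q c / 2.
have mF : measurable_fun [set: R] F.
  by apply: measurable_funM => //; apply: measurable_funM => //;
     exact: measurable_maxr.
have exF p q : p <= q -> (c / 2) * (q - p) <= F q - F p.
  rewrite /F => pq; have [cp|pc] := leP c p.
    rewrite max_l ?(le_trans cp)//; clear -cp c0 pq; nra.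
  have [cq|qc] := leP c q; [clear -cq pc c0 pq; nra|clear -qc pc c0 pq; nra].
have mgF : measurable_fun [set: R] (g \o F) by exact: measurableT_comp.
apply: (@le_lt_trans _ _
  (\int[mu]_(q in `[0%R, +oo[) ((M * \1_(`[0, c]) q)%:E + g (F q))))%E.
  have M0 : 0 <= M by apply: le_trans (fM 0 _ _); rewrite // ltW.
  apply: ge0_le_integral => //.
  - exact: measurable_funTS.
  - apply: measurable_funTS; apply: emeasurable_funD => //.
    by apply/measurable_EFinP; apply: measurable_funM.
  - move=> q /=; rewrite in_itv/= andbT => q0.
    have [qc|cq] := leP q c.
      rewrite indicE mem_set/= ?in_itv/= ?q0// mulr1 gE//.
      apply: le_trans (leeDl _ (g0 _)).
      by rewrite lee_fin fM// ler_pdivrMr// mulrC -cE ler_sqr ?nnegrE ?(ltW c0).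
    have -> : F q = q ^+ 2 / 2 by rewrite /F max_l ?(ltW cq)// expr2.
    by apply: leeDr; rewrite lee_fin mulr_ge0// indicE.
rewrite ge0_integralD//=; first last.
- exact: measurable_funTS.
- by apply/measurable_EFinP; apply: measurable_funM.
- move=> q _; rewrite lee_fin mulr_ge0// ?indicE//.
  by apply: le_trans (fM 0 _ _); rewrite // ltW.
apply: lte_add_pinfty.
  under eq_integral do rewrite EFinM.
  rewrite ge0_integralZl_EFin//=.
  - rewrite integral_indic//=; apply: lte_mul_pinfty => //.
      by rewrite lee_fin; apply: le_trans (fM 0 _ _); rewrite // ltW.
    apply: (@le_lt_trans _ _ (mu `[0, c]%classic)).
      by rewrite le_measure ?inE//=; exact: measurableI.
    by rewrite lebesgue_measure_itv/= lte_fin c0 ltry.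
  - exact/measurable_EFinP.
  - by apply: le_trans (fM 0 _ _); rewrite // ltW.
apply: (@le_lt_trans _ _ (\int[mu]_q (g (F q)))%E).
  by apply: ge0_subset_integral.
apply: le_lt_trans (ge0_integral_comp_expanding _ mF exF mg g0) _.
  by rewrite divr_gt0.
apply: lte_mul_pinfty => //; first by rewrite lee_fin divr_ge0// divr_ge0// ltW.
by rewrite -integral_mkcond.
Qed.
End halfsq.

Lemma measurable_set_lt {d} {T : measurableType d} {R : realType} (f g : T -> R) :
  measurable_fun setT f -> measurable_fun setT g ->
  measurable [set x | f x < g x].
Proof.
move=> mf mg; have := measurable_fun_ltr mf mg.
by move=> /(_ measurableT [set true]); rewrite setTI; exact.
Qed.

Lemma measurable_set_le {d} {T : measurableType d} {R : realType} (f g : T -> R) :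
  measurable_fun setT f -> measurable_fun setT g ->
  measurable [set x | f x <= g x].
Proof.
move=> mf mg; have := measurable_fun_ler mf mg.
by move=> /(_ measurableT [set true]); rewrite setTI; exact.
Qed.

(** * Averaging over the radius and the angle *)

Section tail_tonelli.
Context {d : measure_display} {T : measurableType d} {R : realType}.
Variable P : probability T R.
Local Notation mu := (@lebesgue_measure R).

(** Tonelli's theorem for the weight [w] on the region c q < V t. *)
Lemma integral_tail_tonelli (V : {RV P >-> R}) (D : set R) (w c : R -> R) :
  measurable D -> measurable_fun D w -> measurable_fun [set: R] c ->
  (forall q, D q -> 0 <= w q) ->
  let F t := (\int[mu]_(q in D `&` [set q | (c q < V t)%R]) (w q)%:E)%E in
  measurable_fun [set: T] F /\
  (\int[P]_t F t =
   \int[mu]_(q in D) ((w q)%:E * P [set t | (c q < V t)%R]))%E.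
Proof.
move=> mD mw mc w0 F.
pose E := [set p : T * measurableTypeR R | D p.2 /\ c p.2 < V p.1].
have mE : measurable E.
  have -> : E = (snd @^-1` D) `&` [set p | c p.2 < V p.1] by [].
  apply: measurableI.
    by rewrite -(setTI (snd @^-1` D)); exact: measurable_snd.
  by apply: measurable_set_lt; apply: measurableT_comp.
pose f := (fun p : T * measurableTypeR R => (w p.2)%:E) \_ E.
have mf : measurable_fun setT f.
  apply/(measurable_restrictT (fun p : T * measurableTypeR R => (w p.2)%:E)) => //.
  apply/measurable_EFinP; apply: (measurable_comp mD) => //.
    by move=> _ [p [Dp _] <-].
  exact: measurable_funTS.
have f0 p : (0 <= f p)%E.
  by rewrite /f patchE; case: ifP => //; rewrite inE => -[Dp _]; rewrite lee_fin w0.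
have FE t : F t = (\int[mu]_q f (t, q))%E.
  rewrite /F integral_mkcond; apply: eq_integral => q _.
  by rewrite /f !patchE /E; congr (if _ then _ else _); apply/idP/idP; rewrite !inE.
split.
  apply: (eq_measurable_fun (fun t => (\int[mu]_q f (t, q))%E)) => [t _|].
    by rewrite FE.
  exact: measurable_fun_fubini_tonelli_F.
under eq_integral do rewrite FE.
rewrite (fubini_tonelli f)//.
rewrite [RHS]integral_mkcond; apply: eq_integral => q _.
rewrite patchE; case: ifPn; rewrite ?inE ?notin_setE => Dq; last first.
  by apply: integral0_eq => t _; rewrite /f patchE memNset// => -[].
have mV : measurable [set t | c q < V t].
  exact: measurable_set_lt.
transitivity (\int[P]_t ((w q)%:E * (\1_[set t | c q < V t] t)%:E))%E.
  apply: eq_integral => t _; rewrite /f patchE indicE /E.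
  case: ifPn; rewrite ?inE ?notin_setE/=.
    by move=> [_ h]; rewrite mem_set// mule1.
  by move=> h; rewrite memNset ?mule0//= => h'; exact: h.
rewrite ge0_integralZl_EFin ?w0//; last exact/measurable_EFinP.
by rewrite integral_indic// setIT.
Qed.
End tail_tonelli.

Section joint_law.
Context {d : measure_display} {T : measurableType d} {R : realType}.
Variable P : probability T R.
Local Notation mu := (@lebesgue_measure R).

(** Under independence the joint law is the product of the marginal laws, by
    uniqueness of a measure with prescribed values on rectangles. *)
Lemma joint_law_section (V W : {RV P >-> R}) (S : set (R * R)) :
  independent_RV V W -> measurable S ->
  P [set t | S (V t, W t)] = (\int[P]_t distribution P W (xsection S (V t)))%E.
Proof.
move=> VW mS.
have mVW : measurable_fun setT (fun t => (V t, W t)).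
  by apply: measurable_fun_pair.
pose Fm := isMeasurableFun.Build _ _ _ _ _ mVW.
pose G : {mfun T >-> (R * R)%type} := HB.pack (fun t => (V t, W t)) Fm.
transitivity ((distribution P V \x distribution P W)%E S).
  have := @product_measure_unique _ _ _ _ R (distribution P V) (distribution P W)
     (distribution P G).
  move=> ->//.
rewrite /product_measure1 ge0_integral_distribution//.
exact: measurable_fun_xsection.
Qed.

(** The factor 2 pi is kept on the left so that arc lengths are never divided;
    it cancels in conditional probabilities. *)
Lemma uniform_angle_itv (U : {RV P >-> R}) (A : set R) :
  uniform_angle U -> measurable A ->
  ((2 * pi)%:E * distribution P U A =
   mu (A `&` `[(- (pi / 2))%R, (3 * pi / 2)%R]))%E.
Proof.
move=> uU mA; rewrite uU// /uniform_prob integral_uniform_pdf.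
have pi0 := pi_gt0 R.
have mB : measurable (A `&` `[(- (pi / 2))%R, (3 * pi / 2)%R]).
  exact: measurableI.
under eq_integral.
  move=> x; rewrite inE/= => -[_]; rewrite in_itv/= => xI.
  rewrite /uniform_pdf xI (_ : 3 * pi / 2 - - (pi / 2) = 2 * pi); last by field.
  over.
rewrite integral_cst// muleA -EFinM divff ?mul1e//.
by rewrite gt_eqF// mulr_gt0.
Qed.

Lemma measurable_polar_section (V U : {RV P >-> R}) (S : set (R * R)) :
  uniform_angle U -> measurable S -> measurable_fun [set: T]
    (fun t => mu (xsection S (V t) `&` `[(- (pi / 2))%R, (3 * pi / 2)%R])).
Proof.
move=> uU mS.
have mx : measurable_fun [set: R] (fun v => distribution P U (xsection S v)).
  exact: measurable_fun_xsection.
apply: (eq_measurable_fun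
  (fun t => (2 * pi)%:E * distribution P U (xsection S (V t)))%E) => [t _|].
  by rewrite uniform_angle_itv//; exact: measurable_xsection.
by apply: measurable_funeM; exact: (measurableT_comp mx).
Qed.

Lemma polar_law_section (V U : {RV P >-> R}) (S : set (R * R)) :
  independent_RV V U -> uniform_angle U -> measurable S ->
  ((2 * pi)%:E * P [set t | S (V t, U t)] =
   \int[P]_t mu (xsection S (V t) `&` `[(- (pi / 2))%R, (3 * pi / 2)%R]))%E.
Proof.
move=> VU uU mS; rewrite joint_law_section//.
rewrite -ge0_integralZl_EFin//; first last.
- by rewrite mulr_ge0// ltW// pi_gt0.
- have mx : measurable_fun [set: R] (fun v => distribution P U (xsection S v)).
    exact: measurable_fun_xsection.
  exact: (measurableT_comp mx).
by apply: eq_integral => t _; rewrite uniform_angle_itv//; exact: measurable_xsection.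
Qed.
End joint_law.

(** * The coordinate along the ray *)

Section secant_angle.
Context {R : realType}.
Implicit Types v a b h : R.
Local Notation mu := (@lebesgue_measure R).

Lemma integral_is_derive (F f : R -> R) (a b : R) : a <= b ->
  (forall x, a <= x <= b -> is_derive x 1 F (f x)) ->
  (forall x, a <= x <= b -> {for x, continuous f}) ->
  (\int[mu]_(x in `[a, b]) (f x)%:E = (F b - F a)%:E)%E.
Proof.
rewrite le_eqVlt => /predU1P[<- _ _|ab dF cf].
  by rewrite set_itv1 integral_set1 subrr.
have cF x : a <= x <= b -> {for x, continuous F}.
  move=> /dF H; apply: differentiable_continuous; exact/derivable1_diffP.
rewrite EFinB; apply: continuous_FTC2 => //.
- by apply: continuous_in_subspaceT => x /[!inE]/= /[!in_itv]/=; exact: cf.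
- split.
  + by move=> x /[!in_itv]/= /andP[/ltW ax /ltW xb]; have [] := dF x; rewrite ?ax.
  + by apply: cvg_at_right_filter; apply: cF; rewrite lexx ltW.
  + by apply: cvg_at_left_filter; apply: cF; rewrite lexx ltW.
- move=> x /[!in_itv]/= /andP[/ltW ax /ltW xb].
  have := dF x; rewrite ax xb => /(_ isT) H.
  by rewrite derive1E derive_val.
Qed.

(** [sec_angle v] is the angle u of the sign of v with 1 / cos u = 1 + v^2 / 2,
    and [sec_tan v] is its tangent.  Inverting the cosine would hide that u is
    smooth and odd in v, also at v = 0. *)
Definition sec_tan v : R := v * Num.sqrt (1 + v ^+ 2 / 4).
Definition sec_angle v : R := atan (sec_tan v).
Definition sec_angle_deriv v : R :=
  ((1 + v ^+ 2 / 2) * Num.sqrt (1 + v ^+ 2 / 4))^-1.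

Lemma sqr_quarter_gt0 v : 0 < 1 + v ^+ 2 / 4.
Proof. by rewrite ltr_wpDr// divr_ge0 ?sqr_ge0. Qed.

Lemma sqr_half_gt0 v : 0 < 1 + v ^+ 2 / 2.
Proof. by rewrite ltr_wpDr// divr_ge0 ?sqr_ge0. Qed.

Lemma tan_sec_angle v : tan (sec_angle v) = sec_tan v.
Proof. exact: atanK. Qed.

Lemma sec_tan_sec_angle v :
  1 + sec_tan v ^+ 2 = (1 + v ^+ 2 / 2) ^+ 2.
Proof. by rewrite /sec_tan exprMn sqr_sqrtr; [field|exact/ltW/sqr_quarter_gt0]. Qed.

Lemma cos_sec_angle v : cos (sec_angle v) = (1 + v ^+ 2 / 2)^-1.
Proof.
by rewrite cos_atan sec_tan_sec_angle sqrtr_sqr ger0_norm// ltW// sqr_half_gt0.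
Qed.

Lemma is_derive_sec_angle v : is_derive v 1 sec_angle (sec_angle_deriv v).
Proof.
have q0 := sqr_quarter_gt0 v; have h0 := sqr_half_gt0 v.
have s0 : 0 < Num.sqrt (1 + v ^+ 2 / 4) by rewrite sqrtr_gt0.
have dq : is_derive v 1 (fun v : R => 1 + v ^+ 2 / 4) (v / 2).
  by apply: is_derive_eq; rewrite /GRing.scale/=; field.
have ds : is_derive v 1 (fun v : R => Num.sqrt (1 + v ^+ 2 / 4))
   (((2 * Num.sqrt (1 + v ^+ 2 / 4))^-1) * (v / 2)).
  exact: (@is_derive1_comp _ Num.sqrt (fun v => 1 + v ^+ 2 / 4) v _ _ (is_derive1_sqrt q0) dq).
have dt := is_deriveM (is_derive_id v 1) ds.
rewrite /sec_angle /sec_tan.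
apply: is_derive_eq.
rewrite /sec_angle_deriv /GRing.scale/= -/(sec_tan v) sec_tan_sec_angle.
have sE : Num.sqrt (1 + v ^+ 2 / 4) ^+ 2 = 1 + v ^+ 2 / 4.
  by rewrite sqr_sqrtr// ltW.
set s := Num.sqrt _ in s0 sE *.
have hE : 1 + v ^+ 2 / 2 = 2 * s ^+ 2 - 1 by rewrite sE; field.
have vE : v ^+ 2 = 4 * (s ^+ 2 - 1) by rewrite sE; field.
(* The numerator is the derivative of [sec_tan]; dividing it by the squared
   secant leaves the inverse of one secant. *)
have -> : v * ((2 * s)^-1 * (v / 2)) + s * 1 = (1 + v ^+ 2 / 2) / s.
  rewrite (_ : v * _ = v ^+ 2 / (4 * s)); last by field; rewrite gt_eqF.
  by rewrite hE vE; field; rewrite gt_eqF.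
by field; rewrite (gt_eqF s0)/= gt_eqF// ltr_wpDr// sqr_ge0.
Qed.

Lemma continuous_sec_angle_deriv : continuous sec_angle_deriv.
Proof.
move=> v; apply: cvgV.
  by rewrite gt_eqF// mulr_gt0 ?sqr_half_gt0// sqrtr_gt0 sqr_quarter_gt0.
have csq k : {for v, continuous (fun v : R => 1 + v ^+ 2 / k)}.
  by apply: cvgD; [exact: cvg_cst|apply: cvgMl; exact: exprn_continuous].
apply: cvgM; first exact: csq.
apply: (@continuous_comp _ _ _ (fun v : R => 1 + v ^+ 2 / 4) Num.sqrt).
  exact: csq.
exact: sqrt_continuous.
Qed.

Lemma integral_sec_angle_deriv h a b : a <= b ->
  (\int[mu]_(q in `[a, b]) (h * sec_angle_deriv (h * q))%:E =
   (sec_angle (h * b) - sec_angle (h * a))%:E)%E.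
Proof.
move=> ab; apply: (@integral_is_derive (fun q => sec_angle (h * q))) => // x _.
  have dh : is_derive x 1 (fun q : R => h * q) h.
    by apply: is_derive_eq; rewrite /GRing.scale/= mulr1.
  rewrite mulrC.
  exact: (@is_derive1_comp _ sec_angle _ x _ _ (is_derive_sec_angle _) dh).
apply: cvgMr; apply: (@continuous_comp _ _ _ ( *%R h)).
  by apply: cvgMr; exact: cvg_id.
exact: continuous_sec_angle_deriv.
Qed.

Lemma sec_tanN v : sec_tan (- v) = - sec_tan v.
Proof. by rewrite /sec_tan sqrrN mulNr. Qed.

Lemma sec_angleN v : sec_angle (- v) = - sec_angle v.
Proof. by rewrite /sec_angle sec_tanN atanN. Qed.

Lemma lt_sec_tan : {homo sec_tan : v w / v < w}.
Proof.
have pos v w : 0 <= v -> v < w -> sec_tan v < sec_tan w.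
  move=> v0 vw; apply: ltr_pM => //.
  rewrite ltr_sqrt ?sqr_quarter_gt0// ltrD2l ltr_pM2r//.
  by rewrite ltr_sqr ?nnegrE// ltW// (le_lt_trans v0).
have neg v w : w <= 0 -> v < w -> sec_tan v < sec_tan w.
  move=> w0 vw; rewrite -ltrN2 -!sec_tanN; apply: pos; first by rewrite oppr_ge0.
  by rewrite ltrN2.
move=> v w vw; have [v0|/ltW v0] := leP 0 v; first exact: pos.
have [w0|w0] := leP w 0; first exact: neg.
have s0 : sec_tan 0 = 0 by rewrite /sec_tan mul0r.
have : sec_tan v <= sec_tan 0.
  by move: v0; rewrite le_eqVlt => /predU1P[->//|v0]; rewrite ltW// neg.
by move=> /le_lt_trans; apply; exact: pos.
Qed.

Lemma ltr_sec_tan : {mono sec_tan : v w / v < w}.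
Proof. by apply: leW_mono; exact/le_mono/lt_sec_tan. Qed.

Lemma ler_sec_tan : {mono sec_tan : v w / v <= w}.
Proof. exact/le_mono/lt_sec_tan. Qed.

Lemma sec_angle_lt v : - (pi / 2) < sec_angle v < pi / 2.
Proof. by rewrite atan_gtNpi2 atan_ltpi2. Qed.

Lemma sec_angle_gt0 v : 0 < v -> 0 < sec_angle v.
Proof.
move=> v0; rewrite -(atan0 R); apply: lt_atan.
by rewrite /sec_tan mulr_gt0// sqrtr_gt0 sqr_quarter_gt0.
Qed.

End secant_angle.

(** * The coordinate along the half-line *)

Section acos_primitive.
Context {R : realType}.
Implicit Types a b eps eta s : R.
Local Notation mu := (@lebesgue_measure R).

(** Up to the factor eta, the derivative of a |-> acos (eta / a).  The factor
    stays outside: eta may be negative, while the kernel serves as a nonnegative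
    weight in Tonelli's theorem. *)
Definition acos_kernel eta a : R := (a * Num.sqrt (a ^+ 2 - eta ^+ 2))^-1.

Lemma acos_kernel_dom eta a : `|eta| < 1 -> 1 <= a -> 0 < a ^+ 2 - eta ^+ 2.
Proof.
move=> eta1 a1; rewrite subr_gt0 -(real_normK (num_real eta)).
by rewrite ltr_sqr ?nnegrE// ?(lt_le_trans eta1)// (le_trans _ a1).
Qed.

Lemma is_derive_acos_recip eta a : `|eta| < 1 -> 1 <= a ->
  is_derive a 1 (fun a => acos (eta / a)) (eta * acos_kernel eta a).
Proof.
move=> eta1 a1; have a0 : 0 < a by exact: lt_le_trans a1.
have D0 := acos_kernel_dom eta1 a1.
have etaa : -1 < eta / a < 1.
  by rewrite -ltr_norml normrM normfV (gtr0_norm a0) ltr_pdivrMr// mul1r (lt_le_trans eta1).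
have dV : is_derive a 1 (fun a : R => eta / a) (eta * (- a ^- 2)).
  have := @is_deriveV _ id a 1 1 (lt0r_neq0 a0) (is_derive_id a 1).
  move=> H; apply: is_derive_eq.
  by rewrite /GRing.scale/= mulr1.
apply: is_derive_eq.
have -> : 1 - (eta / a) ^+ 2 = (a ^+ 2 - eta ^+ 2) / a ^+ 2.
  by field; rewrite gt_eqF.
rewrite sqrtrM ?(ltW D0)// sqrtrV ?sqr_ge0// sqrtr_sqr gtr0_norm//.
rewrite /acos_kernel; field.
by rewrite !gt_eqF// sqrtr_gt0.
Qed.

Lemma continuous_acos_kernel eta a : `|eta| < 1 -> 1 <= a ->
  {for a, continuous (acos_kernel eta)}.
Proof.
move=> eta1 a1; have a0 : 0 < a by exact: lt_le_trans a1.
have D0 := acos_kernel_dom eta1 a1.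
apply: cvgV; first by rewrite gt_eqF// mulr_gt0// sqrtr_gt0.
apply: cvgM; first exact: cvg_id.
apply: (@continuous_comp _ _ _ (fun a : R => a ^+ 2 - eta ^+ 2) Num.sqrt).
  by apply: cvgB; [exact: exprn_continuous|exact: cvg_cst].
exact: sqrt_continuous.
Qed.

Lemma integral_acos_kernel eta eps a b : `|eta| < 1 -> 0 <= eps ->
  0 <= a -> a <= b ->
  (\int[mu]_(s in `[a, b]) (eta * (eps * acos_kernel eta (1 + eps * s)))%:E =
   (acos (eta / (1 + eps * b)) - acos (eta / (1 + eps * a)))%:E)%E.
Proof.
move=> eta1 eps0 a0 ab.
apply: (@integral_is_derive _ (fun s => acos (eta / (1 + eps * s)))) => // s.
  move=> /andP[as_ _]; have s1 : 1 <= 1 + eps * s.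
    by rewrite lerDl mulr_ge0// (le_trans a0).
  have dh : is_derive s 1 (fun s : R => 1 + eps * s) eps.
    by apply: is_derive_eq; rewrite /GRing.scale/=; ring.
  rewrite [X in is_derive _ _ _ X](_ : _ =
    eta * acos_kernel eta (1 + eps * s) * eps); last by ring.
  exact: (@is_derive1_comp _ (fun a => acos (eta / a)) _ s _ _
    (is_derive_acos_recip eta1 s1) dh).
move=> /andP[as_ _]; have s1 : 1 <= 1 + eps * s.
  by rewrite lerDl mulr_ge0// (le_trans a0).
apply: cvgMr; apply: cvgMr.
apply: (@continuous_comp _ _ _ (fun s : R => 1 + eps * s)).
  by apply: cvgD; [exact: cvg_cst|apply: cvgMr; exact: cvg_id].
exact: continuous_acos_kernel.
Qed.

End acos_primitive.

(** * Sections of the quadrant by circles *)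

Section polar_section.
Context {R : realType}.
Local Notation mu := (@lebesgue_measure R).
Variables (rho p : R).
Hypotheses (rho0 : 0 <= rho) (rho1 : rho < 1).
Local Notation sg := (Num.sqrt (1 - rho ^+ 2)).
Local Notation eta := (rho + sg * sec_tan p).
Local Notation theta := (acos rho).
Hypotheses (eta1 : `|eta| < 1) (rhop : rho * sec_tan p <= sg).

Let rhoI : -1 <= rho <= 1.
Proof. by rewrite (ltW rho1) andbT (le_trans _ rho0)// lerN10. Qed.

Let cos_theta : cos theta = rho.
Proof. by rewrite acosK// in_itv. Qed.

Let sin_theta : sin theta = sg.
Proof. exact: sin_acos. Qed.

Let sg_gt0 : 0 < sg.
Proof. by rewrite sqrtr_gt0 subr_gt0 expr_lt1. Qed.

Let theta_gt0 : 0 < theta.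
Proof. by apply: acos_gt0; rewrite rho1 andbT (le_trans _ rho0)// lerN10. Qed.

Let theta_le : theta <= pi / 2.
Proof.
rewrite leNgt; apply/negP => h.
have : cos theta < cos (pi / 2).
  have p0 := pi_gt0 R.
  have tI : theta \in `[0, pi] by rewrite in_itv/= acos_ge0//= acos_lepi.
  have hI : pi / 2 \in `[0, pi : R] by rewrite in_itv/=; apply/andP; split; lra.
  by rewrite ltr_cos.
by rewrite cos_theta cos_pihalf ltNge rho0.
Qed.

(** The conditions on X and Y are symmetric: with R = 1, Y is the cosine of the
    angle to the direction theta. *)
Let cosB_theta (u : R) : rho * cos u + sg * sin u = cos (u - theta).
Proof. by rewrite cosB cos_theta sin_theta; ring. Qed.

Let cos_sec_theta (w : R) : cos (sec_angle w - theta) =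
  cos (sec_angle w) * (rho + sg * sec_tan w).
Proof.
have c0 : cos (sec_angle w) != 0.
  by rewrite cos_sec_angle gt_eqF// invr_gt0 sqr_half_gt0.
by rewrite -cosB_theta -[sec_tan w]tan_sec_angle /tan; field.
Qed.

Let cos_sec_gt0 (w : R) : 0 < cos (sec_angle w).
Proof. by rewrite cos_sec_angle invr_gt0 sqr_half_gt0. Qed.

(** The hypothesis [rhop] says that the direction of the corner is at most
    theta, since tan theta = sg / rho. *)
Let angle_le_theta (w : R) : w <= p -> sec_angle w <= theta.
Proof.
move=> wp.
have : 0 <= sin (theta - sec_angle w).
  rewrite sinB sin_theta cos_theta.
  have -> : sg * cos (sec_angle w) - rho * sin (sec_angle w) =
     cos (sec_angle w) * (sg - rho * sec_tan w).
    rewrite -[sec_tan w]tan_sec_angle /tan; field.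
    by rewrite gt_eqF.
  rewrite mulr_ge0 ?(ltW (cos_sec_gt0 w))// subr_ge0 (le_trans _ rhop)//.
  by rewrite ler_wpM2l// ler_sec_tan.
apply: contraTT; rewrite -!ltNge => tw.
have /andP[_ w2] := sec_angle_lt w.
rewrite -[_ - _]opprB sinN oppr_lt0 sin_gt0_pi// subr_gt0 tw/=.
have := pi_gt0 R; have := theta_gt0; lra.
Qed.

(** Of the two points where the circle through the corner (1, eta) meets the
    line Y = eta, the corner is the one reached before the direction theta. *)
Lemma acos_base_angle : acos (eta / (1 + p ^+ 2 / 2)) = theta - sec_angle p.
Proof.
have -> : eta / (1 + p ^+ 2 / 2) = cos (theta - sec_angle p).
  by rewrite -cosN opprB cos_sec_theta cos_sec_angle mulrC.
rewrite cosK// in_itv/= subr_ge0 angle_le_theta//=.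
by have /andP[p1 _] := sec_angle_lt p; have := theta_le; lra.
Qed.

Let cos_abs_lt (u v : R) : `|u| <= pi -> `|v| <= pi ->
  (cos u < cos v) = (`|v| < `|u|).
Proof.
move=> u1 v1; have I (x : R) : `|x| <= pi -> `|x| \in `[0, pi] by rewrite in_itv/= normr_ge0.
by rewrite -(cos_norm u) -(cos_norm v) ltr_cos//; exact: I.
Qed.

Let cos_abs_le (u v : R) : `|u| <= pi -> `|v| <= pi ->
  (cos u <= cos v) = (`|v| <= `|u|).
Proof. by move=> u1 v1; rewrite !leNgt cos_abs_lt. Qed.

Lemma cos_gt_section (w u : R) : 0 < w ->
  - (pi / 2) <= u <= 3 * pi / 2 ->
  (1 < (1 + w ^+ 2 / 2) * cos u) = (- sec_angle w < u < sec_angle w).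
Proof.
move=> w0 /andP[u1 u2]; have k0 := sqr_half_gt0 w.
have pi0 := pi_gt0 R.
have /andP[a1 a2] := sec_angle_lt w; have a0 := sec_angle_gt0 w0.
have -> : (1 < (1 + w ^+ 2 / 2) * cos u) = (cos (sec_angle w) < cos u).
  by rewrite cos_sec_angle -[X in X < cos u]mul1r ltr_pdivrMr// mulrC.
rewrite -ltr_norml.
have [upi|upi] := leP u pi.
  rewrite cos_abs_lt ?(gtr0_norm a0)//; last by rewrite ler_norml; lra.
  lra.
have -> : (`|u| < sec_angle w) = false.
  by apply/negbTE; rewrite -leNgt gtr0_norm; lra.
apply/negbTE; rewrite -leNgt (@le_trans _ _ 0)//; last exact/ltW.
have -> : u = (u - pi) + pi by ring.
rewrite cosDpi oppr_le0; apply: cos_ge0_pihalf; lra.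
Qed.

(** The angles u at which the circle of radius k meets the quadrant X > 1,
    Y <= eta.  By homogeneity the general case reduces to x = 1. *)
Definition polar_event (k : R) : set R :=
  [set u | 1 < k * cos u /\ k * (rho * cos u + sg * sin u) <= eta] `&`
  `[- (pi / 2), 3 * pi / 2].

(** The arc |u| < a ends at or below the corner, hence before the direction theta,
    so Y increases along it and stays at most eta. *)
Lemma polar_event_full (w : R) : 0 < w -> w <= p ->
  polar_event (1 + w ^+ 2 / 2) = `]- sec_angle w, sec_angle w[%classic.
Proof.
move=> w0 wp; have k0 := sqr_half_gt0 w.
have /andP[a1 a2] := sec_angle_lt w; have a0 := sec_angle_gt0 w0.
have pi0 := pi_gt0 R; have th := theta_le; have at_ := angle_le_theta wp.
apply/seteqP; split => [u [[uc _]]|u]/=; rewrite !in_itv/=.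
  by move=> uI; rewrite -cos_gt_section.
move=> uI; have uI2 : - (pi / 2) <= u <= 3 * pi / 2 by lra.
split => //.
split; first by rewrite cos_gt_section.
rewrite cosB_theta -ler_pdivlMl// mulrC.
apply: (@le_trans _ _ (cos (sec_angle w - theta))).
  rewrite cos_abs_le; [|rewrite ler_norml; lra|rewrite ler_norml; lra].
  by rewrite !ler0_norm; lra.
rewrite cos_sec_theta cos_sec_angle [leLHS]mulrC ler_pM2r ?invr_gt0//.
by rewrite lerD2l ler_pM2l// ler_sec_tan.
Qed.

(** Only possible for p < 0: the circle is still inside the radius of the corner,
    so that all its points with X > 1 lie above the line Y = eta. *)
Lemma polar_event_empty (w : R) : 0 < w -> w <= - p ->
  polar_event (1 + w ^+ 2 / 2) = set0.
Proof.
move=> w0 wp; have k0 := sqr_half_gt0 w.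
have /andP[a1 a2] := sec_angle_lt w; have a0 := sec_angle_gt0 w0.
have pi0 := pi_gt0 R; have th := theta_le; have th0 := theta_gt0.
rewrite -subset0 => u [[uc +]]/= uI; rewrite in_itv/= in uI.
rewrite cos_gt_section// in uc; apply/negP; rewrite -ltNge.
rewrite cosB_theta -ltr_pdivrMl// mulrC.
apply: (@le_lt_trans _ _ (cos (sec_angle (- w) - theta))).
  rewrite cos_sec_theta cos_sec_angle sqrrN [leRHS]mulrC ler_pM2r ?invr_gt0//.
  by rewrite lerD2l ler_pM2l// ler_sec_tan lerNr.
rewrite sec_angleN cos_abs_lt; [|rewrite ler_norml; lra|rewrite ler_norml; lra].
by rewrite ltr_norml (@ltr0_norm _ (_ - theta)); lra.
Qed.

(** The points with Y > eta are those at an angle less than b from theta.  The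
    upper end of the arc |u| < a is among them and its lower end is not, so they
    cut off exactly the part above theta - b. *)
Lemma polar_event_mid (w : R) : `|p| < w ->
  let b := acos (eta / (1 + w ^+ 2 / 2)) in
  - sec_angle w < theta - b < sec_angle w /\
  polar_event (1 + w ^+ 2 / 2) = `]- sec_angle w, theta - b]%classic.
Proof.
move=> pw b; have k0 := sqr_half_gt0 w.
have w0 : 0 < w by rewrite (le_lt_trans _ pw).
have /andP[a1 a2] := sec_angle_lt w; have a0 := sec_angle_gt0 w0.
have pi0 := pi_gt0 R; have th := theta_le; have th0 := theta_gt0.
have kI : -1 <= eta / (1 + w ^+ 2 / 2) <= 1.
  rewrite -ler_norml normrM normfV (gtr0_norm k0) ler_pdivrMr// mul1r.
  by rewrite (le_trans (ltW eta1))// lerDl divr_ge0 ?sqr_ge0.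
have b0 : 0 <= b by exact: acos_ge0.
have bpi : b <= pi by exact: acos_lepi.
have cosb : cos b = eta / (1 + w ^+ 2 / 2) by rewrite /b acosK// in_itv.
have cosaT : cos b < cos (sec_angle w - theta).
  rewrite cosb cos_sec_theta cos_sec_angle [ltRHS]mulrC ltr_pM2r ?invr_gt0//.
  by rewrite ltrD2l ltr_pM2l// ltr_sec_tan (le_lt_trans _ pw)// ler_norm.
have cosNaT : cos (- sec_angle w - theta) < cos b.
  rewrite cosb -sec_angleN cos_sec_theta cos_sec_angle sqrrN.
  rewrite [ltLHS]mulrC ltr_pM2r ?invr_gt0//.
  rewrite ltrD2l ltr_pM2l// ltr_sec_tan ltrNl (le_lt_trans _ pw)//.
  by rewrite -normrN ler_norm.
have aT : `|sec_angle w - theta| < b.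
  move: cosaT; rewrite cos_abs_lt ?(ger0_norm b0)//; rewrite ler_norml; lra.
have NaT : b < sec_angle w + theta.
  move: cosNaT; rewrite cos_abs_lt ?(ger0_norm b0)//; last by rewrite ler_norml; lra.
  by rewrite ltr0_norm; lra.
have mid : - sec_angle w < theta - b < sec_angle w.
  by move: aT; rewrite ltr_norml; lra.
split => //.
apply/seteqP; split => [u [[uc +]]|u]/=; rewrite !in_itv/=.
  move=> + uI; rewrite cos_gt_section// in uc.
  rewrite cosB_theta -ler_pdivlMl// mulrC -cosb.
  rewrite cos_abs_le; [|rewrite ler_norml; lra|rewrite ger0_norm//].
  rewrite (ger0_norm b0) ler_normr; move: aT; rewrite ltr_norml; lra.
move=> uI; have uI2 : - (pi / 2) <= u <= 3 * pi / 2 by lra.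
split => //.
split; first by rewrite cos_gt_section//; lra.
rewrite cosB_theta -ler_pdivlMl// mulrC -cosb.
rewrite cos_abs_le; [|rewrite ler_norml; lra|rewrite ger0_norm//].
by rewrite (ger0_norm b0) ler_normr; lra.
Qed.
End polar_section.

(** * Arc lengths as integrals along the boundary of the quadrant *)

Lemma max0E {R : realDomainType} (e : R) : Num.max e 0 = e + Num.max (- e) 0.
Proof. by have [] := leP e 0; have [] := leP (- e) 0; lra. Qed.

Section arc_length.
Context {R : realType}.
Local Notation mu := (@lebesgue_measure R).
Variables (rho h q0 : R).
Hypotheses (rho0 : 0 <= rho) (rho1 : rho < 1) (h0 : 0 < h).
Local Notation sg := (Num.sqrt (1 - rho ^+ 2)).
Local Notation p := (h * q0).
Local Notation eta := (rho + sg * sec_tan p).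
Hypotheses (eta1 : `|eta| < 1) (rhop : rho * sec_tan p <= sg).

Definition ray_weight q : R := h * sec_angle_deriv (h * q).
Definition cut_weight s : R := h ^+ 2 * acos_kernel eta (1 + h ^+ 2 * s).

Lemma sec_angle_deriv_gt0 (v : R) : 0 < sec_angle_deriv v.
Proof.
by rewrite invr_gt0 mulr_gt0 ?sqr_half_gt0// sqrtr_gt0 sqr_quarter_gt0.
Qed.

Lemma ray_weight_ge0 q : 0 <= ray_weight q.
Proof. by rewrite mulr_ge0 ?(ltW h0)// ltW// sec_angle_deriv_gt0. Qed.

Lemma continuous_ray_weight : continuous ray_weight.
Proof.
move=> q; apply: cvgMr; apply: (@continuous_comp _ _ _ ( *%R h)).
  by apply: cvgMr; exact: cvg_id.
exact: continuous_sec_angle_deriv.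
Qed.

Lemma measurable_ray_weight : measurable_fun [set: R] ray_weight.
Proof. by apply: continuous_measurable_fun; exact: continuous_ray_weight. Qed.

Let cut_arg_ge1 s : 0 <= s -> 1 <= 1 + h ^+ 2 * s.
Proof. by move=> s0; rewrite lerDl mulr_ge0// sqr_ge0. Qed.

Lemma cut_weight_ge0 s : 0 <= s -> 0 <= cut_weight s.
Proof.
move=> s0; rewrite mulr_ge0 ?sqr_ge0// invr_ge0 mulr_ge0 ?sqrtr_ge0//.
by rewrite (le_trans _ (cut_arg_ge1 s0)).
Qed.

Lemma continuous_cut_weight s : 0 <= s -> {for s, continuous cut_weight}.
Proof.
move=> s0; apply: cvgMr.
apply: (@continuous_comp _ _ _ (fun s : R => 1 + h ^+ 2 * s)).
  by apply: cvgD; [exact: cvg_cst|apply: cvgMr; exact: cvg_id].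
by apply: continuous_acos_kernel => //; exact: cut_arg_ge1.
Qed.

Lemma measurable_cut_weight (i : interval R) : [set` i] `<=` `[0, +oo[ ->
  measurable_fun [set` i] cut_weight.
Proof.
move=> i0; apply: subspace_continuous_measurable_fun => //.
apply: continuous_in_subspaceT => s /[!inE]/= si.
by apply: continuous_cut_weight; have := i0 _ si; rewrite /= in_itv/= andbT.
Qed.

(** The contributions of the ray and of the half-line to the length of the arc of
    radius k.  On the ray the point of coordinate q has radius 1 + (h q)^2 / 2; on
    the half-line s is chosen so that the radius is 1 + h^2 s. *)
Definition ray_mass (k : R) : \bar R :=
  \int[mu]_(q in `]-oo, q0] `&` [set q | (1 + (h * q) ^+ 2 / 2 < k)%R])
     (ray_weight q)%:E.

Definition cut_mass (k : R) : \bar R :=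
  \int[mu]_(s in `[(q0 ^+ 2 / 2)%R, +oo[ `&` [set s | (1 + h ^+ 2 * s < k)%R])
     (cut_weight s)%:E.

Let abs_lt_ray (w q : R) : 0 < w ->
  (1 + (h * q) ^+ 2 / 2 < 1 + w ^+ 2 / 2) = (- (w / h) < q < w / h).
Proof.
move=> w0; rewrite ltrD2l ltr_pM2r// -[_ ^+ 2](real_normK (num_real _)).
rewrite ltr_sqr ?nnegrE ?(ltW w0)// normrM (gtr0_norm h0).
by rewrite mulrC -ltr_pdivlMr// ltr_norml.
Qed.

Lemma ray_mass_le1 (k : R) : k <= 1 -> ray_mass k = 0%E.
Proof.
move=> k1; rewrite /ray_mass [X in integral _ X](_ : _ = set0) ?integral_set0//.
rewrite -subset0 => q [_ /=]; apply/negP; rewrite -leNgt (le_trans k1)//.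
by rewrite lerDl divr_ge0 ?sqr_ge0.
Qed.

Lemma cut_mass_eq0 (k : R) : k <= 1 + p ^+ 2 / 2 -> cut_mass k = 0%E.
Proof.
move=> k1; rewrite /cut_mass [X in integral _ X](_ : _ = set0) ?integral_set0//.
rewrite -subset0 => s [/=]; rewrite in_itv/= andbT => qs.
apply/negP; rewrite -leNgt (le_trans k1)// lerD2l exprMn -mulrA.
by rewrite ler_wpM2l ?sqr_ge0.
Qed.

Lemma ray_massE (w : R) : 0 < w -> - w <= p ->
  ray_mass (1 + w ^+ 2 / 2) = (sec_angle (Num.min w p) + sec_angle w)%:E.
Proof.
move=> w0 wp; rewrite /ray_mass.
have whE : h * (w / h) = w by rewrite mulrC divfK// gt_eqF.
have mr i : measurable_fun [set` i] (EFin \o ray_weight).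
  by apply/measurable_EFinP; apply: measurable_funTS; exact: measurable_ray_weight.
have wq : - (w / h) <= q0 by rewrite -mulNr ler_pdivrMr// mulrC.
have [wp'|pw] := leP w p.
  rewrite [X in integral _ X](_ : _ = `]- (w / h), w / h[%classic); last first.
    apply/seteqP; split => q /=; rewrite !in_itv/= abs_lt_ray//.
      by move=> [_].
    move=> /[dup] /andP[_ qw] ->; split => //.
    by rewrite (le_trans (ltW qw))// ler_pdivrMr// mulrC.
  rewrite (@integral_itv_bndo_bndc _ (BRight _))// integral_itv_obnd_cbnd//.
  rewrite integral_sec_angle_deriv; last first.
    by have := divr_gt0 w0 h0; lra.
  by rewrite mulrN whE sec_angleN opprK.
rewrite [X in integral _ X](_ : _ = `]- (w / h), q0]%classic); last first.
  apply/seteqP; split => q /=; rewrite !in_itv/= abs_lt_ray//.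
    by move=> [-> /andP[->]].
  move=> /andP[-> qq0]; rewrite qq0; split => //=.
  by rewrite (le_lt_trans qq0)// ltr_pdivlMr// mulrC.
rewrite integral_itv_obnd_cbnd// integral_sec_angle_deriv//.
by rewrite mulrN whE sec_angleN opprK.
Qed.

Lemma ray_mass_eq0 (w : R) : 0 < w -> p <= - w ->
  ray_mass (1 + w ^+ 2 / 2) = 0%E.
Proof.
move=> w0 wp; rewrite /ray_mass [X in integral _ X](_ : _ = set0) ?integral_set0//.
rewrite -subset0 => q [/=]; rewrite in_itv/= abs_lt_ray// => qq0 /andP[+ _].
apply/negP; rewrite -leNgt (le_trans qq0)// -mulNr ler_pdivlMr// mulrC//.
Qed.

(** The kernel is a derivative only after multiplication by eta, which may
    vanish, so the increment of the arc cosine determines [eta * B] and not the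
    mass [B] itself. *)
Lemma cut_massE (w : R) : `|p| < w -> exists2 B,
  cut_mass (1 + w ^+ 2 / 2) = B%:E &
  eta * B = acos (eta / (1 + w ^+ 2 / 2)) - acos (eta / (1 + p ^+ 2 / 2)).
Proof.
move=> pw; have w0 : 0 < w by rewrite (le_lt_trans _ pw).
have h20 : 0 < h ^+ 2 by rewrite exprn_gt0.
have q20 : 0 <= q0 ^+ 2 / 2 by rewrite divr_ge0 ?sqr_ge0.
set S := w ^+ 2 / 2 / h ^+ 2.
have hS : h ^+ 2 * S = w ^+ 2 / 2 by rewrite mulrC divfK// gt_eqF.
have qS : q0 ^+ 2 / 2 <= S.
  rewrite ler_pdivlMr// mulrAC ler_pM2r// -exprMn mulrC.
  rewrite -[_ ^+ 2](real_normK (num_real _)) ler_sqr ?nnegrE ?(ltW w0)//.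
  exact: ltW.
have -> : cut_mass (1 + w ^+ 2 / 2) =
    (\int[mu]_(s in `[(q0 ^+ 2 / 2)%R, S]) (cut_weight s)%:E)%E.
  rewrite /cut_mass [X in integral _ X](_ : _ = `[q0 ^+ 2 / 2, S[%classic).
    rewrite integral_itv_bndo_bndc//; apply/measurable_EFinP.
    apply: measurable_cut_weight => s /=; rewrite !in_itv/= => /andP[+ _].
    by move=> /(le_trans q20) ->.
  apply/seteqP; split => s /=; rewrite !in_itv/= andbT ltrD2l -hS ltr_pM2l//.
    by move=> [-> ->].
  by move=> /andP[].
have cw : {within `[q0 ^+ 2 / 2, S], continuous cut_weight}.
  apply: continuous_in_subspaceT => s /[!inE]/= /[!in_itv]/= /andP[qs _].
  by apply: continuous_cut_weight; exact: le_trans qs.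
have iw := continuous_compact_integrable (@segment_compact _ _ _) cw.
exists (\int[mu]_(s in `[(q0 ^+ 2 / 2)%R, S]) (cut_weight s))%R.
  by rewrite /Rintegral fineK//; exact: integrable_fin_num iw.
rewrite -RintegralZl// /Rintegral.
have := integral_acos_kernel eta1 (ltW h20) q20 qS.
rewrite /cut_weight => ->/=; rewrite hS; congr (_ - acos (_ / (1 + _))).
by rewrite exprMn mulrA.
Qed.

(** For a circle beyond the corner the arc has length a + theta - b.  The ray
    contributes a + sec_angle p and eta times the half-line mass is the increment
    b - (theta - sec_angle p), by [acos_base_angle].  As eta may be negative when
    rho = 0, both parts of eta are kept on opposite sides, so that the identity
    can be integrated without any finiteness assumption. *)
Lemma arc_length_decomposition (k : R) : 0 < k ->
  (mu (polar_event rho p k) + (Num.max eta 0)%:E * cut_mass k =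
   ray_mass k + (Num.max (- eta) 0)%:E * cut_mass k)%E.
Proof.
move=> k0; have [k1|k1] := leP k 1.
  rewrite ray_mass_le1// cut_mass_eq0; last first.
    by rewrite (le_trans k1)// lerDl divr_ge0 ?sqr_ge0.
  rewrite (_ : polar_event _ _ _ = set0) ?measure0 ?mule0//.
  rewrite -subset0 => u [[+ _] _]; apply/negP; rewrite -leNgt.
  by rewrite (le_trans _ k1)// ler_piMr ?cos_le1// ltW.
have [w w0 ->] : exists2 w, 0 < w & k = 1 + w ^+ 2 / 2.
  exists (Num.sqrt (2 * (k - 1))); first by rewrite sqrtr_gt0; lra.
  by rewrite sqr_sqrtr; lra.
have [wp|pw] := leP w p.
  rewrite polar_event_full// cut_mass_eq0 ?mule0 ?adde0; last first.
    by rewrite lerD2l ler_pM2r// ler_sqr ?nnegrE ?(ltW w0)// (le_trans _ wp)// ltW.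
  rewrite ray_massE//; last by lra.
  rewrite min_l// lebesgue_measure_itv/= lte_fin ifT; last first.
    by have := sec_angle_gt0 w0; lra.
  by rewrite -EFinB opprK.
have [wp|pw'] := leP p (- w).
  rewrite polar_event_empty//; last by lra.
  rewrite ray_mass_eq0// measure0 cut_mass_eq0 ?mule0//.
  rewrite lerD2l ler_pM2r// -[leRHS]sqrrN ler_sqr ?nnegrE ?(ltW w0)//; lra.
have pa : `|p| < w by rewrite ltr_norml pw pw'.
have [/= mid ->] := polar_event_mid rho0 rho1 eta1 pa.
have [B -> BE] := cut_massE pa.
rewrite (acos_base_angle rho0 rho1 rhop) in BE.
rewrite ray_massE//; last exact: ltW.
rewrite min_r ?(ltW pw)// lebesgue_measure_itv/= lte_fin ifT; last first.
  by case/andP: mid.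
rewrite -!EFinM -EFinB -!EFinD; congr EFin.
rewrite [Num.max eta 0]max0E [(_ + Num.max _ _) * _]mulrDl BE; ring.
Qed.

(** Without the constraint on Y the whole line X = 1 contributes. *)
Lemma half_plane_arc_length (k : R) : 0 < k ->
  (mu ([set u | (1 < k * cos u)%R] `&` `[(- (pi / 2))%R, (3 * pi / 2)%R]) =
   \int[mu]_(q in setT `&` [set q | (1 + (h * q) ^+ 2 / 2 < k)%R])
     (ray_weight q)%:E)%E.
Proof.
move=> k0; rewrite setTI; have [k1|k1] := leP k 1.
  rewrite [X in integral _ X](_ : _ = set0) ?integral_set0//; last first.
    rewrite -subset0 => q /=; apply/negP; rewrite -leNgt (le_trans k1)//.
    by rewrite lerDl divr_ge0 ?sqr_ge0.
  rewrite [X in mu X](_ : _ = set0) ?measure0//.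
  rewrite -subset0 => u [+ _] /=; apply/negP; rewrite -leNgt.
  by rewrite (le_trans _ k1)// ler_piMr ?cos_le1// ltW.
have [w w0 ->] : exists2 w, 0 < w & k = 1 + w ^+ 2 / 2.
  exists (Num.sqrt (2 * (k - 1))); first by rewrite sqrtr_gt0; lra.
  by rewrite sqr_sqrtr; lra.
have whE : h * (w / h) = w by rewrite mulrC divfK// gt_eqF.
have a0 := sec_angle_gt0 w0; have /andP[a1 a2] := sec_angle_lt w.
have pi0 := pi_gt0 R.
rewrite [X in mu X](_ : _ = `]- sec_angle w, sec_angle w[%classic); last first.
  apply/seteqP; split => u /=; rewrite !in_itv/=.
    by move=> [+ uI]; rewrite cos_gt_section.
  move=> uI; have uI2 : - (pi / 2) <= u <= 3 * pi / 2 by lra.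
  by rewrite cos_gt_section.
have mr i : measurable_fun [set` i] (EFin \o ray_weight).
  by apply/measurable_EFinP; apply: measurable_funTS; exact: measurable_ray_weight.
rewrite [X in integral _ X](_ : _ = `]- (w / h), w / h[%classic); last first.
  by apply/seteqP; split => q /=; rewrite in_itv/= abs_lt_ray.
rewrite (@integral_itv_bndo_bndc _ (BRight _))// integral_itv_obnd_cbnd//.
rewrite integral_sec_angle_deriv; last by have := divr_gt0 w0 h0; lra.
rewrite mulrN whE sec_angleN opprK lebesgue_measure_itv/= lte_fin ifT; last by lra.
by rewrite -EFinB opprK.
Qed.

End arc_length.

(** * Exact formula for the conditional probability *)

Lemma ge0_integral_balance {d} {T : measurableType d} {R : realType}
    (m : {measure set T -> \bar R}) (f g r : T -> \bar R) (a b : R) :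
  measurable_fun setT f -> measurable_fun setT g -> measurable_fun setT r ->
  (forall t, 0 <= f t)%E -> (forall t, 0 <= g t)%E -> (forall t, 0 <= r t)%E ->
  0 <= a -> 0 <= b ->
  (forall t, f t + a%:E * g t = r t + b%:E * g t)%E ->
  (\int[m]_t f t + a%:E * \int[m]_t g t =
   \int[m]_t r t + b%:E * \int[m]_t g t)%E.
Proof.
move=> mf mg mr f0 g0 r0 a0 b0 fgr.
have mZ (e : R) : measurable_fun setT (fun t => e%:E * g t)%E.
  exact: measurable_funeM.
have gZ (e : R) t : 0 <= e -> (0 <= e%:E * g t)%E by move=> e0; rewrite mule_ge0.
rewrite -!ge0_integralZl_EFin// -ge0_integralD//; last by move=> t _; exact: gZ.
rewrite -ge0_integralD//; last by move=> t _; exact: gZ.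
exact: eq_integral.
Qed.

Section representation.
Context {d : measure_display} {T : measurableType d} {R : realType}.
Variable P : probability T R.
Local Notation mu := (@lebesgue_measure R).
Variables (Rad U : {RV P >-> R}) (rho h q0 x : R).
Hypotheses (indep : independent_RV Rad U) (unif : uniform_angle U).
Hypotheses (rho0 : 0 <= rho) (rho1 : rho < 1) (h0 : 0 < h) (x0 : 0 < x).
Local Notation sg := (Num.sqrt (1 - rho ^+ 2)).
Local Notation p := (h * q0).
Local Notation eta := (rho + sg * sec_tan p).
Hypotheses (eta1 : `|eta| < 1) (rhop : rho * sec_tan p <= sg).
Local Notation tailR := (fun c => P [set t | c < Rad t]).

Let measurable_arg (f : R -> R) : measurable_fun [set: R] f ->
  measurable_fun [set: R] (fun q => x * (1 + f q)).
Proof. by move=> mf; apply: measurable_funM => //; exact: measurable_funD. Qed.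

Let set_arg (D : set R) (f : R -> R) (r : R) :
  D `&` [set q | x * (1 + f q) < r] = D `&` [set q | 1 + f q < r / x].
Proof. by apply/seteqP; split => q /= [Dq]; rewrite ltr_pdivlMr// mulrC. Qed.

Let mhsq : measurable_fun [set: R] (fun q => (h * q) ^+ 2 / 2).
Proof. by do !apply: measurable_funM => //; apply: measurable_funX; exact: measurable_funM. Qed.

Let q20 : 0 <= q0 ^+ 2 / 2. Proof. by rewrite divr_ge0 ?sqr_ge0. Qed.

Let itv_ge0 : `[q0 ^+ 2 / 2, +oo[ `<=` `[0, +oo[.
Proof. by move=> s /=; rewrite !in_itv/= !andbT; exact: le_trans. Qed.

Let cut_ge0 s : `[q0 ^+ 2 / 2, +oo[%classic s -> 0 <= cut_weight rho h q0 s.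
Proof.
by move=> /itv_ge0; rewrite /= in_itv/= andbT => ?; exact: cut_weight_ge0.
Qed.

Let mh2 : measurable_fun [set: R] (fun s => h ^+ 2 * s).
Proof. exact: measurable_funM. Qed.

(** A circle of radius r reaches the point of the line X = x of coordinate q as
    soon as r exceeds the distance x (1 + (h q)^2 / 2) of that point to the
    origin, so exchanging the integrals makes the tail of the radius appear. *)
Lemma polar_probability_half_plane :
  ((2 * pi)%:E * P [set t | (0 < Rad t /\ x < Rad t * cos (U t))%R] =
   \int[mu]_q ((ray_weight h q)%:E * tailR (x * (1 + (h * q) ^+ 2 / 2))%R))%E.
Proof.
pose S := [set ru : R * R | 0 < ru.1 /\ x < ru.1 * cos ru.2].
have mcos : measurable_fun [set: R * R] (fun ru : R * R => cos ru.2).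
  apply: measurableT_comp => //; apply: continuous_measurable_fun.
  exact: continuous_cos.
have mS : measurable S.
  apply: measurableI; apply: measurable_set_lt => //.
  exact: measurable_funM.
rewrite (polar_law_section indep unif mS).
have [_ <-] := integral_tail_tonelli Rad
  measurableT (measurable_funTS (measurable_ray_weight h))
  (measurable_arg mhsq) (fun q _ => ray_weight_ge0 h0 q).
apply: eq_integral => t _; rewrite set_arg.
have [r0|r0] := ltP 0 (Rad t).
  rewrite -half_plane_arc_length//; last exact: divr_gt0.
  congr (mu (_ `&` _)); apply/seteqP; split => u; rewrite /xsection/= inE /S/=.
    by move=> [_]; rewrite mulrAC ltr_pdivlMr// mul1r.
  by rewrite mulrAC ltr_pdivlMr// mul1r.
rewrite (_ : xsection _ _ = set0) ?set0I ?measure0.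
  rewrite [X in integral _ X](_ : _ = set0) ?integral_set0//.
  rewrite -subset0 => q [_ /=]; apply/negP; rewrite -leNgt.
  apply: (@le_trans _ _ 0); first by rewrite pmulr_lle0// invr_gt0.
  by rewrite addr_ge0// divr_ge0// sqr_ge0.
rewrite -subset0 => u; rewrite /xsection/= inE /S/= => -[].
by rewrite ltNge r0.
Qed.

Lemma polar_probability_quadrant :
  ((2 * pi)%:E * P [set t | (0 < Rad t /\ x < Rad t * cos (U t) /\
       Rad t * (rho * cos (U t) + sg * sin (U t)) <= x * eta)%R] +
   (Num.max eta 0)%:E * \int[mu]_(s in `[(q0 ^+ 2 / 2)%R, +oo[)
     ((cut_weight rho h q0 s)%:E * tailR (x * (1 + h ^+ 2 * s))%R) =
   \int[mu]_(q in `]-oo, q0])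
     ((ray_weight h q)%:E * tailR (x * (1 + (h * q) ^+ 2 / 2))%R) +
   (Num.max (- eta) 0)%:E * \int[mu]_(s in `[(q0 ^+ 2 / 2)%R, +oo[)
     ((cut_weight rho h q0 s)%:E * tailR (x * (1 + h ^+ 2 * s))%R))%E.
Proof.
pose S := [set ru : R * R | 0 < ru.1 /\ x < ru.1 * cos ru.2 /\
   ru.1 * (rho * cos ru.2 + sg * sin ru.2) <= x * eta].
have mcos : measurable_fun [set: R * R] (fun ru : R * R => cos ru.2).
  apply: measurableT_comp => //; apply: continuous_measurable_fun.
  exact: continuous_cos.
have msin : measurable_fun [set: R * R] (fun ru : R * R => sin ru.2).
  apply: measurableT_comp => //; apply: continuous_measurable_fun.
  exact: continuous_sin.
have mS : measurable S.
  apply: measurableI; first exact: measurable_set_lt.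
  apply: measurableI.
    by apply: measurable_set_lt => //; exact: measurable_funM.
  apply: measurable_set_le => //; apply: measurable_funM => //.
  by apply: measurable_funD => //; exact: measurable_funM.
rewrite (polar_law_section indep unif mS).
have [mr <-] := integral_tail_tonelli Rad
  (measurable_itv `]-oo, q0]) (measurable_funTS (measurable_ray_weight h))
  (measurable_arg mhsq) (fun q _ => ray_weight_ge0 h0 q).
have [mc <-] := integral_tail_tonelli Rad
  (measurable_itv `[q0 ^+ 2 / 2, +oo[) (measurable_cut_weight eta1 itv_ge0)
  (measurable_arg mh2) cut_ge0.
have mpos (e : R) : 0 <= Num.max e 0 by rewrite le_max lexx orbT.
have ray0 t : (0 <= \int[mu]_(q in `]-oo, q0] `&`
    [set q | (x * (1 + (h * q) ^+ 2 / 2) < Rad t)%R]) (ray_weight h q)%:E)%E.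
  by apply: integral_ge0 => q _; rewrite lee_fin ray_weight_ge0.
have cut0 t : (0 <= \int[mu]_(s in `[(q0 ^+ 2 / 2)%R, +oo[ `&`
    [set s | (x * (1 + h ^+ 2 * s) < Rad t)%R]) (cut_weight rho h q0 s)%:E)%E.
  by apply: integral_ge0 => q [/cut_ge0 + _]; rewrite lee_fin.
apply: ge0_integral_balance => //.
  exact: (measurable_polar_section Rad unif mS).
move=> t; rewrite !set_arg.
have [r0|r0] := ltP 0 (Rad t).
  have := arc_length_decomposition rho0 rho1 h0 eta1 rhop (divr_gt0 r0 x0).
  rewrite /cut_mass /ray_mass => <-.
  congr (mu (_ `&` _) + _)%E; apply/seteqP; split => u; rewrite /xsection/= inE /S/=.
    move=> [_ [H1 H2]]; split; first by rewrite mulrAC ltr_pdivlMr// mul1r.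
    by rewrite mulrAC ler_pdivrMr// [leRHS]mulrC.
  move=> [H1 H2]; split => //; move: H1 H2; rewrite mulrAC ltr_pdivlMr// mul1r => ->.
  by rewrite mulrAC ler_pdivrMr// [leRHS]mulrC.
rewrite (_ : xsection _ _ = set0) ?set0I ?measure0.
  have rx : Rad t / x <= 0 by rewrite pmulr_lle0// invr_gt0.
  have := ray_mass_le1 h q0 (le_trans rx ler01).
  have := @cut_mass_eq0 _ rho h q0 (Rad t / x).
  rewrite /cut_mass /ray_mass => ->; last first.
    by rewrite (le_trans rx)// addr_ge0// divr_ge0// sqr_ge0.
  by move=> ->; rewrite !mule0.
rewrite -subset0 => u; rewrite /xsection/= inE /S/= => -[].
by rewrite ltNge r0.
Qed.

End representation.

(** * Real-valued integrals *)

Section integrable_real.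
Context {d} {T : measurableType d} {R : realType}.
Variables (m : {measure set T -> \bar R}) (D : set T) (mD : measurable D).
Implicit Types a b : T -> R.

Lemma integrable_realD a b :
  m.-integrable D (EFin \o a) -> m.-integrable D (EFin \o b) ->
  m.-integrable D (EFin \o (fun x => a x + b x)).
Proof. by move=> ia ib; exact: (integrableD mD ia ib). Qed.

Lemma integrable_realB a b :
  m.-integrable D (EFin \o a) -> m.-integrable D (EFin \o b) ->
  m.-integrable D (EFin \o (fun x => a x - b x)).
Proof. by move=> ia ib; exact: (integrableB mD ia ib). Qed.

Lemma integrable_realZ (k : R) a :
  m.-integrable D (EFin \o a) -> m.-integrable D (EFin \o (fun x => k * a x)).
Proof. by move=> ia; exact: (integrableZl mD k ia). Qed.

Lemma le_integrable_real a b : measurable_fun D a ->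
  (forall x, D x -> `|a x| <= b x) ->
  m.-integrable D (EFin \o b) -> m.-integrable D (EFin \o a).
Proof.
move=> ma ab; apply: le_integrable => //; first exact/measurable_EFinP.
by move=> x Dx /=; rewrite lee_fin (le_trans (ab x Dx))// ler_norm.
Qed.

(** Integrability of [a] is part of the conclusion: it follows from that of [b]
    and [e], and the comparison of the integrals has no meaning without it. *)
Lemma Rintegral_dist_le a b e :
  measurable_fun D a ->
  m.-integrable D (EFin \o b) -> m.-integrable D (EFin \o e) ->
  (forall x, D x -> `|a x - b x| <= e x) ->
  m.-integrable D (EFin \o a) /\
  `|\int[m]_(x in D) a x - \int[m]_(x in D) b x| <= \int[m]_(x in D) e x.
Proof.
move=> ma ib ie abe.
have ia : m.-integrable D (EFin \o a).
  have := integrable_realD (integrable_norm ib) ie.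
  apply: le_integrable_real => // x Dx /=.
  have := abe _ Dx; have := ler_normD (a x - b x) (b x).
  by rewrite subrK; lra.
split => //; have iab := integrable_realB ia ib.
rewrite -RintegralB//; apply: le_trans (le_normr_Rintegral mD iab) _.
by apply: le_Rintegral => //; exact: (integrable_norm iab).
Qed.

End integrable_real.

Lemma Rintegral_subset_le {d} {T : measurableType d} {R : realType}
    (m : {measure set T -> \bar R}) (A B : set T) (e : T -> R) :
  measurable A -> measurable B -> A `<=` B ->
  m.-integrable B (EFin \o e) -> (forall x, B x -> 0 <= e x) ->
  \int[m]_(x in A) e x <= \int[m]_(x in B) e x.
Proof.
move=> mA mB AB ie e0; have iA := integrableS mB mA AB ie.
apply: fine_le; [exact: integrable_fin_num iA|exact: integrable_fin_num ie|].
by apply: ge0_subset_integral => //; exact: measurable_int ie.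
Qed.

(** * Gaussian and exponential integrals *)

Section integral_estimates.
Context {R : realType}.
Local Notation mu := (@lebesgue_measure R).

Lemma expRN_lipschitz (u v : R) : 0 <= u -> 0 <= v ->
  `|expR (- u) - expR (- v)| <= `|u - v|.
Proof.
wlog uv : u v / u <= v.
  move=> H u0 v0; have [/H|/ltW /H] := leP u v; first exact.
  by rewrite distrC (distrC u); exact.
move=> u0 v0; rewrite distrC (distrC u) ler0_norm; last first.
  by rewrite subr_le0 ler_expR lerN2.
rewrite (ger0_norm (_ : 0 <= v - u)) ?subr_ge0// opprB.
have -> : expR (- v) = expR (- u) * expR (- (v - u)).
  by rewrite -expRD; congr expR; ring.
have e1 : expR (- u) <= 1 by rewrite -expR0 ler_expR oppr_le0.
have e2 := expR_ge1Dx (- (v - u)).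
have e3 := expR_gt0 (- u).
nra.
Qed.

Definition gauss (q : R) : R := expR (- (q ^+ 2 / 2)).

Lemma gauss_ge0 q : 0 <= gauss q. Proof. exact: expR_ge0. Qed.

Lemma gauss_le1 q : gauss q <= 1.
Proof. by rewrite -expR0 ler_expR oppr_le0 divr_ge0 ?sqr_ge0. Qed.

Lemma measurable_gauss : measurable_fun [set: R] gauss.
Proof.
apply: measurableT_comp => //; apply: measurableT_comp => //.
by apply: measurable_funM => //; exact: measurable_funX.
Qed.

Let sqrt2pi_gt0 : 0 < Num.sqrt (2 * pi) :> R.
Proof. by rewrite sqrtr_gt0 mulr_gt0// pi_gt0. Qed.

Lemma phi_gauss q : gauss q = Num.sqrt (2 * pi) * phi q.
Proof. by rewrite phiE mulrC divfK// gt_eqF. Qed.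

Lemma integrable_gauss : mu.-integrable setT (EFin \o gauss).
Proof.
have := integrable_realZ measurableT (Num.sqrt (2 * pi)) (integrable_normal_pdf (0 : R) 1).
by apply: eq_integrable => // q _ /=; rewrite phi_gauss.
Qed.

Lemma integral_gauss_Phi (z : R) :
  \int[mu]_(q in `]-oo, z]) gauss q = Num.sqrt (2 * pi) * Phi z.
Proof.
rewrite /Phi /normal_prob -/(Rintegral _ _ _) -RintegralZl//; last first.
  by apply: integrableS (integrable_normal_pdf (0 : R) 1).
by apply: eq_Rintegral => q _; rewrite phi_gauss.
Qed.

Lemma integral_gauss : \int[mu]_q gauss q = Num.sqrt (2 * pi).
Proof.
transitivity (Num.sqrt (2 * pi) * \int[mu]_q normal_pdf 0 1 q : R).
  rewrite -RintegralZl//; last exact: integrable_normal_pdf.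
  by apply: eq_Rintegral => q _; rewrite phi_gauss.
by rewrite /Rintegral integral_normal_pdf mulr1.
Qed.

Lemma ler_expR_id (u : R) : u <= expR u.
Proof. by have := expR_ge1Dx u; lra. Qed.

(** Half of the exponent absorbs the factor q^2, and what remains is a normal
    density of variance 2. *)
Lemma sqr_gauss_le q : q ^+ 2 * gauss q <= 4 * expR (- (q ^+ 2 / 4)).
Proof.
rewrite /gauss (_ : - (q ^+ 2 / 2) = - (q ^+ 2 / 4) - q ^+ 2 / 4); last by field.
rewrite expRD mulrA ler_wpM2r ?expR_ge0// expRN ler_pdivrMr ?expR_gt0//.
by have := ler_expR_id (q ^+ 2 / 4); lra.
Qed.

Lemma integrable_sqr_gauss : mu.-integrable setT (EFin \o (fun q => q ^+ 2 * gauss q)).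
Proof.
pose s : R := Num.sqrt 2.
have s0 : 0 < s by rewrite sqrtr_gt0.
have s2 : s ^+ 2 = 2 by rewrite sqr_sqrtr.
have := integrable_realZ measurableT (4 / normal_peak s) (integrable_normal_pdf 0 s).
apply: le_integrable_real => //.
  apply: measurable_funM; first exact: measurable_funX.
  exact: measurable_gauss.
move=> q _ /=; rewrite normal_pdfE ?gt_eqF//.
rewrite mulrA divfK; last by rewrite gt_eqF// normal_peak_gt0// gt_eqF.
rewrite ger0_norm; last by rewrite mulr_ge0 ?sqr_ge0 ?gauss_ge0.
rewrite /normal_fun subr0 s2 (le_trans (sqr_gauss_le q))//.
rewrite ler_pM2l// ler_expR le_eqVlt; apply/orP; left; apply/eqP.
by rewrite -(mulr_natr 2 2) mulNr; congr (- (_ / _)); ring.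
Qed.

End integral_estimates.

Section exponential_estimates.
Context {R : realType}.
Local Notation mu := (@lebesgue_measure R).

Lemma integral_expR_tail (k a : R) : 0 < k ->
  (\int[mu]_(s in `[a, +oo[) (expR (- (k * s)))%:E = (expR (- (k * a)) / k)%:E)%E.
Proof.
move=> k0.
have dF (s : R) : is_derive s 1 (fun s => - (expR (- (k * s)) / k)) (expR (- (k * s))).
  have dk : is_derive s 1 (fun s : R => - (k * s)) (- k).
    by apply: is_derive_eq; rewrite /GRing.scale/=; ring.
  have de := @is_derive1_comp _ expR _ s _ _ (is_derive_expR (- (k * s))) dk.
  have -> : (fun s : R => - (expR (- (k * s)) / k)) =
      (- k^-1) \*: (expR \o (fun s : R => - (k * s))).
    by apply/funext => t /=; rewrite /GRing.scale/= mulNr mulrC.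
  apply: is_derive_eq; rewrite /GRing.scale/=.
  by field; rewrite gt_eqF.
have cont (s : R) : {for s, continuous (fun s : R => expR (- (k * s)))}.
  apply: (@continuous_comp _ _ _ (fun s : R => - (k * s)) expR).
    by apply: cvgN; apply: cvgMr; exact: cvg_id.
  exact: continuous_expR.
rewrite (@ge0_continuous_FTC2y _ _ (fun s => - (expR (- (k * s)) / k)) _ 0).
- by rewrite -EFinB sub0r opprK.
- by move=> s _; exact: expR_ge0.
- by apply: continuous_subspaceT => s; exact: cont.
- rewrite -oppr0 -[X in - X](mul0r k^-1); apply: cvgN; apply: cvgMl.
  apply: (@cvg_comp _ _ _ (fun s => k * s) (fun s => expR (- s))).
    exact: (gt0_cvgMry k0 cvg_id).
  exact: cvgr_expR.
- by move=> s _; have [] := dF s.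
- apply: cvg_at_right_filter.
  by apply: cvgN; apply: cvgMl; exact: cont.
- by move=> s _; rewrite derive1E; have H := dF s; rewrite derive_val.
Qed.

Lemma measurable_expRN (k : R) : measurable_fun [set: R] (fun s : R => expR (- (k * s))).
Proof.
by apply: measurableT_comp => //; apply: measurableT_comp => //; exact: measurable_funM.
Qed.

Lemma integrable_expR_tail (k a : R) : 0 < k ->
  mu.-integrable `[a, +oo[ (EFin \o (fun s => expR (- (k * s)))).
Proof.
move=> k0; apply/integrableP; split.
  by apply/measurable_EFinP; apply: measurable_funTS; exact: measurable_expRN.
under eq_integral do rewrite /= ger0_norm ?expR_ge0//.
by rewrite integral_expR_tail// ltry.
Qed.

Lemma Rintegral_expRN (a : R) : \int[mu]_(s in `[a, +oo[) expR (- s) = expR (- a).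
Proof.
have := @integral_expR_tail 1 a ltr01.
under eq_integral do rewrite mul1r.
by rewrite /Rintegral => ->/=; rewrite mul1r divr1.
Qed.

Lemma integrable_expRN (a : R) :
  mu.-integrable `[a, +oo[ (EFin \o (fun s => expR (- s))).
Proof.
have := @integrable_expR_tail 1 a ltr01.
by apply: eq_integrable => // s _ /=; rewrite mul1r.
Qed.

Lemma integrable_id_expRN :
  mu.-integrable `[0, +oo[ (EFin \o (fun s => s * expR (- s))).
Proof.
have h0 : 0 < 2^-1 :> R by [].
have i := @integrable_expR_tail 2^-1 0 h0.
have mD : measurable (`[0, +oo[%classic : set (measurableTypeR R)) by [].
have := integrable_realZ mD 2 i.
apply: le_integrable_real => //.
  apply: measurable_funTS; apply: measurable_funM => //.
  by apply: measurableT_comp => //; exact: measurableT_comp.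
move=> s /=; rewrite in_itv/= andbT => s0; rewrite ger0_norm ?mulr_ge0 ?expR_ge0//.
rewrite (_ : - s = - (2^-1 * s) - 2^-1 * s); last by field.
rewrite expRD mulrA ler_wpM2r ?expR_ge0// expRN ler_pdivrMr ?expR_gt0//.
by have := ler_expR_id (2^-1 * s); lra.
Qed.

End exponential_estimates.

(** * Replacing the survival ratio by the exponential *)

Section weighted_estimates.
Context {R : realType}.
Local Notation mu := (@lebesgue_measure R).

Lemma sec_angle_deriv_le1 (v : R) : sec_angle_deriv v <= 1.
Proof.
rewrite invf_le1; last by rewrite mulr_gt0 ?sqr_half_gt0// sqrtr_gt0 sqr_quarter_gt0.
have s1 : 1 <= Num.sqrt (1 + v ^+ 2 / 4).
  by rewrite -[leLHS]sqrtr1 ler_sqrt ?lerDl ?divr_ge0 ?sqr_ge0// ltW// sqr_quarter_gt0.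
by rewrite -[leLHS]mul1r ler_pM// lerDl divr_ge0 ?sqr_ge0.
Qed.

Lemma sec_angle_deriv_near1 (v : R) : `|sec_angle_deriv v - 1| <= v ^+ 2.
Proof.
have q0 := sqr_quarter_gt0 v; have h0 := sqr_half_gt0 v.
rewrite distrC ger0_norm ?subr_ge0 ?sec_angle_deriv_le1//.
rewrite lerBlDl -lerBlDr.
have [v1|v1] := leP 1 (v ^+ 2).
  by apply: (@le_trans _ _ 0); [lra|exact/ltW/sec_angle_deriv_gt0].
have sle : Num.sqrt (1 + v ^+ 2 / 4) <= 1 + v ^+ 2 / 4.
  rewrite -[leRHS]sqr_sqrtr ?(ltW q0)// expr2 ler_peMr ?sqrtr_ge0//.
  by rewrite -[leLHS]sqrtr1 ler_sqrt ?lerDl ?divr_ge0 ?sqr_ge0// ltW.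
have s0 : 0 < Num.sqrt (1 + v ^+ 2 / 4) by rewrite sqrtr_gt0.
rewrite /sec_angle_deriv -[leRHS]mul1r ler_pdivlMr; last exact: mulr_gt0.
apply: (@le_trans _ _ ((1 - v ^+ 2) * ((1 + v ^+ 2 / 2) * (1 + v ^+ 2 / 4)))).
  by rewrite ler_wpM2l ?subr_ge0 ?(ltW v1)// ler_wpM2l// ltW.
have := sqr_ge0 v; move: (v ^+ 2) => y y0; nra.
Qed.

(** The weight is at most 1 and within (h q)^2 of 1, so it may multiply the error
    of [g] for free, and it costs the second moment of the Gaussian. *)
Lemma ray_integral_estimate (h c : R) (g f : R -> R) (D : set R) :
  0 <= c -> measurable D -> measurable_fun [set: R] (fun q => g (q ^+ 2 / 2)) ->
  mu.-integrable setT (EFin \o (fun q => f (q ^+ 2 / 2))) ->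
  (forall t, 0 <= t -> 0 <= f t) ->
  (forall t, 0 <= t -> `|g t - expR (- t)| <= c * f t) ->
  mu.-integrable D (EFin \o (fun q => sec_angle_deriv (h * q) * g (q ^+ 2 / 2))) /\
  `|\int[mu]_(q in D) (sec_angle_deriv (h * q) * g (q ^+ 2 / 2)) -
     \int[mu]_(q in D) gauss q| <=
  h ^+ 2 * \int[mu]_q (q ^+ 2 * gauss q) + c * \int[mu]_q f (q ^+ 2 / 2).
Proof.
move=> c0 mD mg If f0 gf.
have sq0 (q : R) : 0 <= q ^+ 2 / 2 by rewrite divr_ge0 ?sqr_ge0.
have mT : measurable ([set: R] : set (measurableTypeR R)) by [].
have mD' : measurable (D : set (measurableTypeR R)) by [].
pose e q := h ^+ 2 * (q ^+ 2 * gauss q) + c * f (q ^+ 2 / 2).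
have e0 q : 0 <= e q.
  by rewrite addr_ge0// mulr_ge0 ?sqr_ge0 ?f0// mulr_ge0 ?sqr_ge0 ?gauss_ge0.
have i1 := integrable_realZ mT (h ^+ 2) integrable_sqr_gauss.
have i2 := integrable_realZ mT c If.
have ie : mu.-integrable setT (EFin \o e) := integrable_realD mT i1 i2.
have [] := @Rintegral_dist_le _ _ _ mu D mD'
    (fun q => sec_angle_deriv (h * q) * g (q ^+ 2 / 2)) gauss e.
- apply: measurable_funTS; apply: measurable_funM => //.
  have cs : continuous (@sec_angle_deriv R) by exact: continuous_sec_angle_deriv.
  apply: (@measurableT_comp _ _ _ _ _ _ (@sec_angle_deriv R)) => //.
  exact: continuous_measurable_fun.
- by apply: integrableS integrable_gauss.
- by apply: integrableS ie.
- move=> q _.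
  have k1 := sec_angle_deriv_le1 (h * q); have k0 := sec_angle_deriv_gt0 (h * q).
  have k2 := sec_angle_deriv_near1 (h * q).
  have -> : sec_angle_deriv (h * q) * g (q ^+ 2 / 2) - gauss q =
    (sec_angle_deriv (h * q) - 1) * gauss q +
    sec_angle_deriv (h * q) * (g (q ^+ 2 / 2) - gauss q) by ring.
  apply: le_trans (ler_normD _ _) _; apply: lerD.
    rewrite normrM (ger0_norm (gauss_ge0 q)) mulrA -exprMn.
    by rewrite ler_wpM2r ?gauss_ge0.
  rewrite normrM (gtr0_norm k0).
  apply: le_trans (gf _ (sq0 q)).
  by rewrite -[leRHS]mul1r ler_wpM2r.
move=> ia; move=> H; split => //; apply: le_trans H _.
rewrite -!RintegralZl//; last exact: integrable_sqr_gauss.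
rewrite -RintegralD//.
by apply: Rintegral_subset_le.
Qed.

Lemma acos_kernel_bounds (delta eta a : R) : 0 < delta ->
  delta ^+ 2 + eta ^+ 2 <= 1 -> 1 <= a ->
  0 <= acos_kernel eta a <= delta^-1.
Proof.
move=> d0 de a1; have a0 : 0 < a by exact: lt_le_trans a1.
have D1 : delta <= Num.sqrt (a ^+ 2 - eta ^+ 2).
  rewrite -[leLHS]gtr0_norm// -sqrtr_sqr ler_sqrt; nra.
have D0 := lt_le_trans d0 D1.
rewrite invr_ge0 mulr_ge0 ?(ltW a0) ?(ltW D0)//= lef_pV2 ?posrE ?mulr_gt0//.
by rewrite -[leLHS]mul1r ler_pM// ltW.
Qed.

(** The value rho / sg is eta * acos_kernel eta a at eta = rho, a = 1.  The
    condition on delta keeps the square root in the kernel at least delta, hence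
    away from its singularity a = |eta|. *)
Lemma acos_kernel_lipschitz (delta rho eta a : R) : 0 < delta ->
  0 <= rho -> rho < 1 -> delta ^+ 2 + eta ^+ 2 <= 1 -> 1 <= a ->
  `|eta * acos_kernel eta a - rho / Num.sqrt (1 - rho ^+ 2)| <=
  (delta^-1 + (Num.sqrt (1 - rho ^+ 2))^-1 +
     2 / (Num.sqrt (1 - rho ^+ 2) ^+ 2 * delta)) * (`|eta - rho| + (a - 1)).
Proof.
move=> d0 rho0 rho1 de a1; set sg := Num.sqrt (1 - rho ^+ 2).
have a0 : 0 < a by exact: lt_le_trans a1.
have rr : 0 < 1 - rho ^+ 2 by rewrite subr_gt0 expr_lt1.
have sg0 : 0 < sg by rewrite sqrtr_gt0.
have sgE : sg ^+ 2 = 1 - rho ^+ 2 by rewrite sqr_sqrtr// ltW.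
have aeta : 0 < a ^+ 2 - eta ^+ 2 by nra.
have DE : Num.sqrt (a ^+ 2 - eta ^+ 2) ^+ 2 = a ^+ 2 - eta ^+ 2.
  by rewrite sqr_sqrtr// ltW.
have D1 : delta <= Num.sqrt (a ^+ 2 - eta ^+ 2).
  rewrite -[leLHS]gtr0_norm// -sqrtr_sqr ler_sqrt; nra.
rewrite /acos_kernel.
set D := Num.sqrt (a ^+ 2 - eta ^+ 2) in DE D1 *.
have D0 := lt_le_trans d0 D1.
set w := `|eta - rho|.
have w0 : 0 <= w by exact: normr_ge0.
have etaw : `|eta - rho| <= w by [].
rewrite ler_norml in etaw; case/andP: etaw => w1 w2.
have eta1 : `|eta| <= 1.
  by rewrite -(@ler_sqr _ _ 1) ?nnegrE// real_normK ?num_real// expr1n; nra.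
rewrite ler_norml in eta1; case/andP: eta1 => e1 e2.
have Dsg : `|D - sg| <= (2 * a * (a - 1) + 2 * w) / sg.
  rewrite ler_pdivlMr//.
  have : `|D - sg| * (D + sg) <= 2 * a * (a - 1) + 2 * w.
    rewrite -[X in _ * X <= _]gtr0_norm ?addr_gt0// -normrM.
    have -> : (D - sg) * (D + sg) = (a - 1) * (a + 1) + (rho - eta) * (rho + eta).
      by rewrite -subr_sqr DE sgE; ring.
    rewrite ler_norml; apply/andP; split; nra.
  apply: le_trans; rewrite ler_wpM2l//; lra.
have -> : eta * (a * D)^-1 - rho / sg =
   ((eta - rho) * sg + rho * (- ((a - 1) * D) - (D - sg))) / (a * D * sg).
  by field; rewrite !gt_eqF.
rewrite normrM normfV (gtr0_norm (_ : 0 < a * D * sg)) ?mulr_gt0//.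
rewrite ler_pdivrMr ?mulr_gt0//.
have num : `|(eta - rho) * sg + rho * (- ((a - 1) * D) - (D - sg))| <=
   w * sg + ((a - 1) * D + (2 * a * (a - 1) + 2 * w) / sg).
  apply: le_trans (ler_normD _ _) _; apply: lerD.
    by rewrite normrM (gtr0_norm sg0).
  rewrite normrM (ger0_norm rho0) -opprD normrN.
  apply: (@le_trans _ _ (1 * `|(a - 1) * D + (D - sg)|)).
    by rewrite ler_wpM2r// ltW.
  rewrite mul1r; apply: le_trans (ler_normD _ _) _; apply: lerD => //.
  by rewrite ger0_norm// mulr_ge0 ?(ltW D0)// subr_ge0.
apply: le_trans num _.
have am : 0 <= a - 1 by rewrite subr_ge0.
have aD : delta <= a * D by rewrite -[leLHS]mul1r ler_pM// ltW.
(* The three terms of the constant absorb the three terms of the numerator. *)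
have D0' := ltW D0; have sg0' := ltW sg0; have d0' := ltW d0; have a0' := ltW a0.
have Dd : 1 <= D / delta by rewrite ler_pdivlMr// mul1r.
have t1 : w * sg <= delta^-1 * (w + (a - 1)) * (a * D * sg).
  rewrite (_ : _ * (a * D * sg) = (w + (a - 1)) * (a * (D / delta)) * sg); last first.
    by field; rewrite gt_eqF.
  have aDd : 1 <= a * (D / delta) by rewrite -[leLHS]mul1r ler_pM.
  rewrite ler_wpM2r//; nra.
have t2 : (a - 1) * D <= sg^-1 * (w + (a - 1)) * (a * D * sg).
  rewrite (_ : _ * (a * D * sg) = (w + (a - 1)) * a * D); last first.
    by field; rewrite gt_eqF.
  rewrite ler_wpM2r//; nra.
have t3 : (2 * a * (a - 1) + 2 * w) / sg <=
   2 / (sg ^+ 2 * delta) * (w + (a - 1)) * (a * D * sg).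
  rewrite (_ : _ * (a * D * sg) = (2 * (w + (a - 1)) * a * (D / delta)) / sg); last first.
    by field; rewrite !gt_eqF.
  rewrite ler_wpM2r ?invr_ge0//.
  apply: (@le_trans _ _ (2 * (w + (a - 1)) * a)); first by nra.
  by rewrite ler_peMr// !mulr_ge0// addr_ge0.
by rewrite !mulrDl; lra.
Qed.

End weighted_estimates.

Section cut_estimate.
Context {R : realType}.
Local Notation mu := (@lebesgue_measure R).

(** The kernel is bounded by 1 / delta, which controls the error of [g]; freezing
    it at rho / sg costs a multiple of |eta - rho| + h^2 s, which is integrable
    against the exponential. *)
Lemma cut_integral_estimate (delta rho eta h c s0 : R) (g f : R -> R) :
  0 < delta -> 0 <= rho -> rho < 1 -> delta ^+ 2 + eta ^+ 2 <= 1 ->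
  0 <= c -> 0 <= s0 -> measurable_fun [set: R] g ->
  mu.-integrable `[0, +oo[ (EFin \o f) ->
  (forall t, 0 <= t -> 0 <= f t) ->
  (forall t, 0 <= t -> `|g t - expR (- t)| <= c * f t) ->
  let sg := Num.sqrt (1 - rho ^+ 2) in
  let L := delta^-1 + sg^-1 + 2 / (sg ^+ 2 * delta) in
  let I := \int[mu]_(s in `[s0, +oo[) (acos_kernel eta (1 + h ^+ 2 * s) * g s) in
  mu.-integrable `[s0, +oo[
    (EFin \o (fun s => acos_kernel eta (1 + h ^+ 2 * s) * g s)) /\
  (`|eta * I - rho / sg * expR (- s0)| <=
  delta^-1 * (c * \int[mu]_(s in `[0, +oo[) f s) +
  L * (`|eta - rho| + h ^+ 2 * \int[mu]_(s in `[0, +oo[) (s * expR (- s)))).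
Proof.
move=> d0 rho0 rho1 de c0 s00 mg If f0 gf sg L I.
have mD : measurable (`[s0, +oo[%classic : set (measurableTypeR R)) by [].
have mD0 : measurable (`[0, +oo[%classic : set (measurableTypeR R)) by [].
have sub : `[s0, +oo[ `<=` `[0, +oo[.
  by move=> s /=; rewrite !in_itv/= !andbT; exact: le_trans.
have ge0 s : `[s0, +oo[%classic s -> 0 <= s.
  by move=> /sub; rewrite /= in_itv/= andbT.
have arg1 s : 0 <= s -> 1 <= 1 + h ^+ 2 * s.
  by move=> s_ge0; rewrite lerDl mulr_ge0// sqr_ge0.
have eta1 : `|eta| < 1.
  by rewrite -(@ltr_sqr _ _ 1) ?nnegrE// real_normK ?num_real// expr1n; nra.
have rr : 0 < 1 - rho ^+ 2 by rewrite subr_gt0 expr_lt1.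
have sg0 : 0 < sg by rewrite sqrtr_gt0.
have L0 : 0 <= L.
  by rewrite !addr_ge0// ?invr_ge0 ?divr_ge0 ?mulr_ge0 ?sqr_ge0 ?(ltW d0) ?(ltW sg0).
have i0 := integrableS mD0 mD sub If.
have ie := integrable_expRN s0.
have ise := integrableS mD0 mD sub (@integrable_id_expRN R).
have mW : measurable_fun `[s0, +oo[ (fun s => acos_kernel eta (1 + h ^+ 2 * s)).
  apply: subspace_continuous_measurable_fun => //.
  apply: continuous_in_subspaceT => s /[!inE]/= /ge0 sge.
  apply: (@continuous_comp _ _ _ (fun s : R => 1 + h ^+ 2 * s)).
    by apply: cvgD; [exact: cvg_cst|apply: cvgMr; exact: cvg_id].
  by apply: continuous_acos_kernel => //; exact: arg1.
have mWg : measurable_fun `[s0, +oo[ (fun s => acos_kernel eta (1 + h ^+ 2 * s) * g s).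
  by apply: measurable_funM => //; exact: measurable_funTS.
have Wb s : `[s0, +oo[%classic s ->
    0 <= acos_kernel eta (1 + h ^+ 2 * s) <= delta^-1.
  by move=> /ge0 sge; apply: acos_kernel_bounds => //; exact: arg1.
have iWg : mu.-integrable `[s0, +oo[
    (EFin \o (fun s => acos_kernel eta (1 + h ^+ 2 * s) * g s)).
  have := integrable_realZ mD delta^-1 (integrable_realD mD (integrable_realZ mD c i0) ie).
  apply: le_integrable_real => // s sD; have /andP[W0 W1] := Wb s sD.
  rewrite normrM (ger0_norm W0) ler_pM//.
  have := gf s (ge0 s sD); have := ler_normD (g s - expR (- s)) (expR (- s)).
  by rewrite subrK (ger0_norm (expR_ge0 _)); lra.
split => //.
pose e1 s := delta^-1 * (c * f s).
pose e2 s := L * (`|eta - rho| * expR (- s) + h ^+ 2 * (s * expR (- s))).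
have icf := integrable_realZ mD c i0.
have ie1 := integrable_realZ mD delta^-1 icf; rewrite -/e1 in ie1.
have iee := integrable_realZ mD `|eta - rho| ie.
have ihe := integrable_realZ mD (h ^+ 2) ise.
have isum := integrable_realD mD iee ihe.
have ie2 := integrable_realZ mD L isum; rewrite -/e2 in ie2.
have irs := integrable_realZ mD (rho / sg) ie.
have [] := @Rintegral_dist_le _ _ _ mu _ mD
    (fun s => eta * (acos_kernel eta (1 + h ^+ 2 * s) * g s))
    (fun s => rho / sg * expR (- s)) (fun s => e1 s + e2 s).
- exact: measurable_funM.
- exact: irs.
- exact: (integrable_realD mD ie1 ie2).
- move=> s sD; have /andP[W0 W1] := Wb s sD; have sge := ge0 s sD.
  set W := acos_kernel _ _ in W0 W1 *.
  have -> : eta * (W * g s) - rho / sg * expR (- s) =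
    eta * W * (g s - expR (- s)) + (eta * W - rho / sg) * expR (- s) by ring.
  apply: le_trans (ler_normD _ _) _; apply: lerD.
    rewrite normrM /e1 ler_pM//; last exact: gf.
    rewrite normrM (ger0_norm W0) -[leRHS]mul1r ler_pM//; exact: ltW.
  rewrite normrM (ger0_norm (expR_ge0 _)) /e2 [h ^+ 2 * _]mulrA -mulrDl mulrA.
  rewrite ler_wpM2r ?expR_ge0//.
  have := acos_kernel_lipschitz d0 rho0 rho1 de (arg1 _ sge).
  by rewrite (_ : 1 + h ^+ 2 * s - 1 = h ^+ 2 * s); last by ring.
move=> _.
rewrite (RintegralZl eta)// (RintegralZl (rho / sg))// Rintegral_expRN => H; apply: le_trans H _.
rewrite RintegralD//; apply: lerD.
  rewrite RintegralZl//.
  rewrite RintegralZl// ler_wpM2l ?invr_ge0 ?(ltW d0)// ler_wpM2l//.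
  by apply: Rintegral_subset_le => // s; rewrite /= in_itv/= andbT; exact: f0.
rewrite RintegralZl// ler_wpM2l// RintegralD//.
apply: lerD.
  rewrite RintegralZl// Rintegral_expRN -[leRHS]mulr1 ler_wpM2l//.
  by rewrite -expR0 ler_expR oppr_le0.
rewrite RintegralZl// ler_wpM2l ?sqr_ge0//.
apply: Rintegral_subset_le => //; first exact: integrable_id_expRN.
by move=> s; rewrite /= in_itv/= andbT => sge; rewrite mulr_ge0// expR_ge0.
Qed.

Lemma Rintegral_gauss_dist (a b : R) : a <= b ->
  \int[mu]_(q in `]-oo, b]) gauss q - \int[mu]_(q in `]-oo, a]) gauss q =
  \int[mu]_(q in `]a, b]) gauss q.
Proof.
move=> ab; apply: Rintegral_itvB => //.
by apply: integrableS (@integrable_gauss R).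
Qed.

Lemma Rintegral_bnd_le (a b K : R) (u : R -> R) : a <= b ->
  mu.-integrable `]a, b] (EFin \o u) -> (forall q, a < q <= b -> `|u q| <= K) ->
  `|\int[mu]_(q in `]a, b]) u q| <= K * (b - a).
Proof.
move=> ab iu uK; have [->|ab'] := eqVneq a b.
  by rewrite set_itvoc0// Rintegral_set0 normr0 subrr mulr0.
have mD : measurable (`]a, b]%classic : set (measurableTypeR R)) by [].
have muE : (mu `]a, b]%classic = (b - a)%:E)%E.
  by rewrite lebesgue_measure_itv/= lte_fin lt_neqAle ab' ab -EFinB.
have K0 : 0 <= K by apply: le_trans (uK b _); rewrite // lexx lt_neqAle ab' ab.
rewrite -lee_fin EFinM -muE EFin_normr_Rintegral//.
apply: le_trans (le_abse_integral _ mD (measurable_int _ iu)) _.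
apply: integral_le_bound => //; first exact: measurable_int iu.
by apply: aeW => q /=; rewrite in_itv/= => qab; rewrite lee_fin uK.
Qed.

Lemma Rintegral_gauss_lipschitz (a b : R) :
  `|\int[mu]_(q in `]-oo, a]) gauss q - \int[mu]_(q in `]-oo, b]) gauss q| <= `|a - b|.
Proof.
wlog ab : a b / a <= b.
  by move=> H; have [/H//|/ltW/H] := leP a b; rewrite distrC (distrC b).
rewrite distrC (distrC a) Rintegral_gauss_dist// (ger0_norm (_ : 0 <= b - a)) ?subr_ge0//.
rewrite -[leRHS]mul1r; apply: Rintegral_bnd_le => //.
  by apply: integrableS (@integrable_gauss R).
by move=> q _; rewrite ger0_norm ?gauss_ge0 ?gauss_le1.
Qed.

Lemma gauss_lipschitz (M a b : R) : `|a| <= M -> `|b| <= M ->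
  `|gauss a - gauss b| <= M * `|a - b|.
Proof.
move=> aM bM; apply: le_trans (expRN_lipschitz _ _) _;
  rewrite ?divr_ge0 ?sqr_ge0//.
have -> : a ^+ 2 / 2 - b ^+ 2 / 2 = (a + b) / 2 * (a - b) by field.
rewrite normrM ler_wpM2r// normrM normfV (ger0_norm (_ : 0 <= 2))//.
by rewrite ler_pdivrMr//; have := ler_normD a b; lra.
Qed.

Lemma Rintegral_gauss_taylor (M a b : R) : a <= b -> `|a| <= M -> `|b| <= M ->
  `|\int[mu]_(q in `]-oo, b]) gauss q - \int[mu]_(q in `]-oo, a]) gauss q
    - (b - a) * gauss a| <= M * (b - a) ^+ 2.
Proof.
move=> ab aM bM; rewrite Rintegral_gauss_dist//.
have ig : mu.-integrable `]a, b] (EFin \o @gauss R).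
  by apply: integrableS (@integrable_gauss R).
have mD : measurable (`]a, b]%classic : set (measurableTypeR R)) by [].
have ic : mu.-integrable `]a, b] (EFin \o (fun=> gauss a)).
  apply: measurable_bounded_integrable => //.
    by rewrite /= lebesgue_measure_itv/=; case: ifP => // _; rewrite -EFinB ltry.
  exact: bounded_cst.
have -> : (b - a) * gauss a = \int[mu]_(q in `]a, b]) gauss a.
  rewrite Rintegral_cst// mulrC; congr (_ * _).
  have := @lebesgue_measure_itv R `]a, b]; rewrite /= => ->.
  rewrite lte_fin; move: ab; rewrite le_eqVlt => /predU1P[->|->//].
  by rewrite ltxx subrr.
rewrite -RintegralB//; have ib := integrable_realB mD ig ic.
apply: le_trans (Rintegral_bnd_le ab ib (K := M * (b - a)) _) _; last first.
  by rewrite expr2 mulrA.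
move=> q /andP[aq qb]; apply: le_trans (gauss_lipschitz (M := M) _ _) _ => //.
  move: aM bM; rewrite !ler_norml; lra.
rewrite ler_wpM2l ?(le_trans _ aM)// ger0_norm ?subr_ge0 ?(ltW aq)//; lra.
Qed.

End cut_estimate.

(** * The coordinate of the corner *)

Section ray_coordinate.
Context {R : realType}.
Implicit Types h z : R.

(** The solution q of [sec_tan (h * q) = h * z], written so that it stays
    meaningful, and close to z, when h tends to 0. *)
Definition ray_coord h z : R :=
  z * Num.sqrt (2 / (1 + Num.sqrt (1 + (h * z) ^+ 2))).

Let secant_ge1 h z : 1 <= Num.sqrt (1 + (h * z) ^+ 2).
Proof. by rewrite -[leLHS]sqrtr1 ler_sqrt ?lerDl ?sqr_ge0// addr_ge0 ?sqr_ge0. Qed.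

Let secantE h z : Num.sqrt (1 + (h * z) ^+ 2) ^+ 2 = 1 + (h * z) ^+ 2.
Proof. by rewrite sqr_sqrtr// addr_ge0 ?sqr_ge0. Qed.

Let factorE h z : Num.sqrt (2 / (1 + Num.sqrt (1 + (h * z) ^+ 2))) ^+ 2 =
  2 / (1 + Num.sqrt (1 + (h * z) ^+ 2)).
Proof. by rewrite sqr_sqrtr// divr_ge0// addr_ge0. Qed.

Lemma sec_tan_ray_coord h z : sec_tan (h * ray_coord h z) = h * z.
Proof.
rewrite /sec_tan /ray_coord.
set D := Num.sqrt (1 + (h * z) ^+ 2).
have D1 : 1 <= D by exact: secant_ge1.
have DE : D ^+ 2 = 1 + (h * z) ^+ 2 by exact: secantE.
set k := Num.sqrt (2 / _).
have kE : k ^+ 2 = 2 / (1 + D) by exact: factorE.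
have k0 : 0 < k by rewrite sqrtr_gt0 divr_gt0//; lra.
have -> : 1 + (h * (z * k)) ^+ 2 / 4 = (k^-1) ^+ 2.
  rewrite mulrA exprMn kE exprVn kE invf_div.
  have -> : (h * z) ^+ 2 = (D - 1) * (D + 1) by rewrite -subr_sqr DE; ring.
  by field; rewrite gt_eqF//; lra.
by rewrite sqrtr_sqr gtr0_norm ?invr_gt0// mulrA mulfK// gt_eqF.
Qed.

Let factor_near1 h z :
  0 <= 1 - 2 / (1 + Num.sqrt (1 + (h * z) ^+ 2)) <= (h * z) ^+ 2.
Proof.
have D1 := secant_ge1 h z; have DE := secantE h z.
set D := Num.sqrt (1 + (h * z) ^+ 2) in D1 DE *.
have Dp : 0 < 1 + D by lra.
have -> : 1 - 2 / (1 + D) = (D - 1) / (1 + D) by field; rewrite gt_eqF.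
apply/andP; split; first by rewrite divr_ge0//; lra.
by rewrite ler_pdivrMr//; nra.
Qed.

Lemma ray_coord_near h z : `|ray_coord h z - z| <= h ^+ 2 * `|z| ^+ 3.
Proof.
have /andP[k1 k2] := factor_near1 h z.
rewrite /ray_coord; have := factorE h z.
set k := Num.sqrt (2 / _); move=> kE; rewrite -kE in k1 k2.
have k0 : 0 <= k by exact: sqrtr_ge0.
have -> : z * k - z = z * (k - 1) by ring.
rewrite normrM distrC [X in _ * X](ger0_norm (_ : 0 <= 1 - k)); last by nra.
have -> : h ^+ 2 * `|z| ^+ 3 = `|z| * (h * z) ^+ 2.
  by rewrite exprMn -[z ^+ 2](real_normK (num_real z)); ring.
rewrite ler_wpM2l//; apply: le_trans k2; nra.
Qed.

Lemma ray_coord_sqr_near h z :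
  `|ray_coord h z ^+ 2 / 2 - z ^+ 2 / 2| <= h ^+ 2 * z ^+ 4.
Proof.
have /andP[k1 k2] := factor_near1 h z.
rewrite /ray_coord exprMn factorE.
set k := 2 / (1 + _) in k1 k2 *.
have -> : z ^+ 2 * k / 2 - z ^+ 2 / 2 = - (z ^+ 2 * ((1 - k) / 2)) by field.
rewrite normrN ger0_norm; last by rewrite mulr_ge0 ?sqr_ge0// divr_ge0.
have -> : h ^+ 2 * z ^+ 4 = z ^+ 2 * (h * z) ^+ 2 by ring.
by rewrite ler_wpM2l ?sqr_ge0//; lra.
Qed.

End ray_coordinate.

(** * The quotient *)

(** [K] is known up to h + c only, and that suffices because it is multiplied by
    [h]; here h * h is part of the error and h * c is at most c. *)
Lemma quotient_estimate {R : realType} (A B s h c Iz I1 K tPhi tK : R) :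
  0 < s -> 0 <= h -> h <= 1 -> 0 <= c -> 0 <= A -> 0 <= B ->
  A * (h ^+ 2 + c) <= s / 2 ->
  `|Iz - s * tPhi| <= A * (h ^+ 2 + c) ->
  `|I1 - s| <= A * (h ^+ 2 + c) ->
  `|K - s * tK| <= A * (h + c) ->
  `|tPhi - h * tK| <= B ->
  `|(Iz - h * K) / I1 - (tPhi - h * tK)| <=
    (2 + B) * A * 2 / s * (h ^+ 2 + c).
Proof.
move=> s0 h0 h1 c0 A0 B0 As HI H1 HK HB.
have e0 : 0 <= h ^+ 2 + c by rewrite addr_ge0// sqr_ge0.
have I1s : s / 2 <= I1 by move: H1; rewrite ler_norml; lra.
have I10 : 0 < I1 by apply: lt_le_trans I1s; lra.
have -> : (Iz - h * K) / I1 - (tPhi - h * tK) =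
  ((Iz - s * tPhi) - h * (K - s * tK) - (tPhi - h * tK) * (I1 - s)) / I1.
  by field; rewrite gt_eqF.
rewrite normrM normfV (gtr0_norm I10) ler_pdivrMr//.
have hK : `|h * (K - s * tK)| <= A * (h ^+ 2 + c).
  rewrite normrM (ger0_norm h0); apply: (@le_trans _ _ (h * (A * (h + c)))).
    by rewrite ler_wpM2l.
  have : h * c <= c by rewrite ler_piMl.
  by move=> hc; nra.
have hB : `|(tPhi - h * tK) * (I1 - s)| <= B * (A * (h ^+ 2 + c)).
  by rewrite normrM ler_pM.
apply: (@le_trans _ _ ((2 + B) * (A * (h ^+ 2 + c)))).
  apply: le_trans (ler_normB _ _) _; have := ler_normB (Iz - s * tPhi) (h * (K - s * tK)).
  lra.
set E := A * (h ^+ 2 + c) in As HI H1 hK hB *.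
have E0 : 0 <= E by rewrite mulr_ge0.
have -> : (2 + B) * A * 2 / s * (h ^+ 2 + c) * I1 = (2 + B) * E * (2 * I1 / s).
  by rewrite /E; field; rewrite gt_eqF.
apply: ler_peMr; first by rewrite mulr_ge0//; lra.
by rewrite ler_pdivlMr// mul1r; lra.
Qed.

(** * From the radial representation to (X, Y) *)

Lemma measure_eq_ae {d} {T : measurableType d} {R : realType}
    (m : {measure set T -> \bar R}) (A B : set T) :
  measurable A -> measurable B -> {ae m, forall t, A t <-> B t} -> m A = m B.
Proof.
move=> mA mB AB; rewrite -[A]setIT -[B]setIT -!integral_indic//.
apply: ge0_ae_eq_integral => //.
- exact/measurable_EFinP.
- exact/measurable_EFinP.
- apply: filterS AB => t AB _ /=; congr EFin; rewrite !indicE.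
  by congr (nat_of_bool _)%:R; apply/idP/idP; rewrite !inE; apply AB.
Qed.

Section conditional_probability.
Context {d : measure_display} {T : measurableType d} {R : realType}.
Variable P : probability T R.
Local Notation mu := (@lebesgue_measure R).
Variables (X Y Rad U : {RV P >-> R}) (rho : R) (H : R -> R).
Hypotheses (rho0 : 0 <= rho) (rho1 : rho < 1).
Hypotheses (indep : independent_RV Rad U) (unif : uniform_angle U).
Hypotheses (Rad_gt0 : {ae P, forall w, 0 < Rad w})
  (cdfE : forall r, cdf Rad r = (H r)%:E)
  (XE : {ae P, forall w, X w = Rad w * cos (U w)})
  (YE : {ae P, forall w, Y w =
    Rad w * (rho * cos (U w) + Num.sqrt (1 - rho ^+ 2) * sin (U w))}).
Local Notation sg := (Num.sqrt (1 - rho ^+ 2)).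

Lemma tail_survival c : P [set t | c < Rad t] = (survival H c)%:E.
Proof.
have := ccdf_1_cdf Rad c; rewrite cdfE /ccdf /distribution /pushforward.
rewrite (_ : Rad @^-1` _ = [set t | c < Rad t]); last first.
  by apply/seteqP; split => t /=; rewrite in_itv/= andbT.
by move=> ->.
Qed.

Lemma measurable_survival : measurable_fun [set: R] (survival H).
Proof.
apply: measurable_funB => //; apply/measurable_EFinP.
apply: (eq_measurable_fun (cdf Rad)) => [r _|]; first by rewrite cdfE.
exact: cdf_measurable.
Qed.

(** For h^2 = psi x / x this is G (x + t psi x) / G x. *)
Definition survival_ratio x h t := survival H (x * (1 + h ^+ 2 * t)) / survival H x.

Lemma measurable_survival_ratio x h : measurable_fun [set: R] (survival_ratio x h).
Proof.
apply: measurable_funM => //.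
apply: (@measurableT_comp _ _ _ _ _ _ (survival H)); first exact: measurable_survival.
by apply: measurable_funM => //; apply: measurable_funD => //; exact: measurable_funM.
Qed.

Let quadrant_prob x y : P ([set w | Y w <= y] `&` [set w | X w > x]) =
  P [set t | (0 < Rad t /\ x < Rad t * cos (U t) /\
       Rad t * (rho * cos (U t) + sg * sin (U t)) <= y)%R].
Proof.
have mcos : measurable_fun [set: T] (fun t => cos (U t)).
  apply: (measurableT_comp (continuous_measurable_fun _)) => //.
  exact: continuous_cos.
have msin : measurable_fun [set: T] (fun t => sin (U t)).
  apply: (measurableT_comp (continuous_measurable_fun _)) => //.
  exact: continuous_sin.
apply: measure_eq_ae.
- by apply: measurableI; [exact: measurable_set_le|exact: measurable_set_lt].
- apply: measurableI; first exact: measurable_set_lt.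
  apply: measurableI.
    by apply: measurable_set_lt => //; exact: measurable_funM.
  apply: measurable_set_le => //; apply: measurable_funM => //.
  by apply: measurable_funD => //; exact: measurable_funM.
- near=> t.
  have R0 : 0 < Rad t by near: t.
  have Xt : X t = Rad t * cos (U t) by near: t.
  have Yt : Y t = Rad t * (rho * cos (U t) + sg * sin (U t)) by near: t.
  by rewrite /= -Xt -Yt; split => [[]|[_ []]].
Unshelve. all: by end_near. Qed.

Let half_plane_prob x : P [set w | X w > x] =
  P [set t | (0 < Rad t /\ x < Rad t * cos (U t))%R].
Proof.
have mcos : measurable_fun [set: T] (fun t => cos (U t)).
  apply: (measurableT_comp (continuous_measurable_fun _)) => //.
  exact: continuous_cos.
apply: measure_eq_ae.
- exact: measurable_set_lt.
- apply: measurableI; first exact: measurable_set_lt.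
  by apply: measurable_set_lt => //; exact: measurable_funM.
- near=> t.
  have R0 : 0 < Rad t by near: t.
  have Xt : X t = Rad t * cos (U t) by near: t.
  by rewrite /= -Xt; split => [|[]].
Unshelve. all: by end_near. Qed.

(** Both probabilities carry the factor h G x / (2 pi), which cancels.  The two
    positive parts of eta recombine into eta once all the terms are known to be
    finite. *)
Lemma cond_prob_formula (x h z : R) :
  0 < x -> 0 < h -> 0 < survival H x ->
  let eta := rho + sg * (h * z) in
  let g := survival_ratio x h in
  let q0 := ray_coord h z in
  let ray q := sec_angle_deriv (h * q) * g (q ^+ 2 / 2) in
  let cut s := acos_kernel eta (1 + h ^+ 2 * s) * g s in
  `|eta| < 1 -> rho * (h * z) <= sg ->
  mu.-integrable setT (EFin \o ray) ->
  mu.-integrable `[q0 ^+ 2 / 2, +oo[ (EFin \o cut) ->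
  cond_prob P [set w | Y w <= x * eta] [set w | X w > x] =
  (\int[mu]_(q in `]-oo, q0]) ray q -
   h * (eta * \int[mu]_(s in `[q0 ^+ 2 / 2, +oo[) cut s)) / \int[mu]_q ray q.
Proof.
move=> x0 h0 Gx0 eta g q0 ray cut eta1 rhop iray icut.
have pi0 := pi_gt0 R.
have tqE : sec_tan (h * q0) = h * z by exact: sec_tan_ray_coord.
set Gx := survival H x in Gx0 *.
have gE t : survival H (x * (1 + h ^+ 2 * t)) = Gx * g t.
  by rewrite /g /survival_ratio [RHS]mulrC divfK// gt_eqF.
have hqE (q : R) : (h * q) ^+ 2 / 2 = h ^+ 2 * (q ^+ 2 / 2).
  by rewrite exprMn mulrA.
have rayE (D : set R) : measurable D ->
  (\int[mu]_(q in D) ((ray_weight h q)%:E *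
     P [set t | (x * (1 + (h * q) ^+ 2 / 2) < Rad t)%R]) =
   (h * Gx * \int[mu]_(q in D) ray q)%:E)%E.
  move=> mD; have iD : mu.-integrable D (EFin \o ray).
    by apply: integrableS iray.
  rewrite -RintegralZl// /Rintegral fineK; last first.
    exact/integrable_fin_num/(integrable_realZ _ (h * Gx) iD).
  apply: eq_integral => q _; rewrite tail_survival -EFinM; congr EFin.
  by rewrite hqE gE /ray_weight /ray; ring.
have cutE : (\int[mu]_(s in `[(q0 ^+ 2 / 2)%R, +oo[)
     ((cut_weight rho h q0 s)%:E * P [set t | (x * (1 + h ^+ 2 * s) < Rad t)%R]) =
   (h ^+ 2 * Gx * \int[mu]_(s in `[(q0 ^+ 2 / 2)%R, +oo[) cut s)%:E)%E.
  rewrite -RintegralZl// /Rintegral fineK; last first.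
    exact/integrable_fin_num/(integrable_realZ _ (h ^+ 2 * Gx) icut).
  apply: eq_integral => s _; rewrite tail_survival -EFinM; congr EFin.
  by rewrite gE /cut_weight /cut tqE; ring.
have := polar_probability_half_plane indep unif h0 x0.
rewrite -half_plane_prob (rayE _ measurableT).
set I1 := \int[mu]_q ray q; move=> E2.
have eta1' : `|rho + sg * sec_tan (h * q0)| < 1 by rewrite tqE.
have rhop' : rho * sec_tan (h * q0) <= sg by rewrite tqE.
have := polar_probability_quadrant indep unif rho0 rho1 h0 x0 eta1' rhop'.
rewrite tqE -/eta.
rewrite -quadrant_prob (rayE _ (measurable_itv _)) cutE.
set Iz := \int[mu]_(q in _) ray q; set K := \int[mu]_(s in _) cut s; move=> E1.
rewrite /cond_prob.
have f1 : P ([set w | Y w <= x * eta] `&` [set w | X w > x]) \is a fin_num.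
  apply: fin_num_measure; apply: measurableI; last exact: measurable_set_lt.
  exact: measurable_set_le.
have f2 : P [set w | X w > x] \is a fin_num.
  by apply: fin_num_measure; exact: measurable_set_lt.
move: E1 E2; rewrite -(fineK f1) -(fineK f2).
set p1 := fine (P (_ `&` _)); set p2 := fine (P [set w | X w > x]).
rewrite -!EFinM -!EFinD => -[E1] -[E2].
have {}E1 : p1 = h * Gx * (Iz - h * (eta * K)) / (2 * pi).
  apply: (@mulfI _ (2 * pi)); first by rewrite gt_eqF// mulr_gt0.
  rewrite mulrC [RHS]mulrC divfK; last by rewrite gt_eqF// mulr_gt0.
  move: E1; rewrite (max0E eta); lra.
have {}E2 : p2 = h * Gx * I1 / (2 * pi).
  apply: (@mulfI _ (2 * pi)); first by rewrite gt_eqF// mulr_gt0.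
  by rewrite E2 [RHS]mulrC divfK// gt_eqF// mulr_gt0.
rewrite E1 E2 /=.
have [->|I10] := eqVneq I1 0; first by rewrite !mulr0 mul0r invr0 !mulr0.
have ratio (a b c k : R) : a != 0 -> c != 0 -> k != 0 ->
    a * b / k / (a * c / k) = b / c.
  by move=> a0 c0 k0; field; rewrite a0 c0 k0.
by apply: ratio => //; rewrite gt_eqF ?mulr_gt0.
Qed.

End conditional_probability.

(** This is the only use of local boundedness, at the single point 0, where
    q |-> q^2 / 2 has a critical point. *)
Lemma integrable_comp_halfsq {R : realType} (f : R -> R) :
  [locally [bounded f t | t in `[0, +oo[]] ->
  (@lebesgue_measure R).-integrable `[0, +oo[ (EFin \o f) ->
  (@lebesgue_measure R).-integrable setT (EFin \o (fun q => `|f (q ^+ 2 / 2)|)).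
Proof.
move=> bf If.
have [delta d0 [M fM]] : exists2 delta : R, 0 < delta &
    exists M, forall t, 0 <= t -> t <= delta -> `|f t| <= M.
  have /bf [M [_ fM]] : `[0, +oo[%classic (0 : R) by rewrite /= in_itv/= lexx.
  have := fM (M + 1); rewrite ltrDl => /(_ ltr01).
  move=> [e /= e0 He]; exists (e / 2); first exact: divr_gt0.
  exists (M + 1) => t t0 te; apply: He.
    by rewrite /= sub0r normrN ger0_norm//; lra.
  by rewrite /= in_itv/= t0.
apply/integrableP; split.
  apply/measurable_EFinP; apply: measurableT_comp => //.
  have mf : measurable_fun (`[0, +oo[%classic : set R) f.
    by apply/measurable_EFinP; exact: measurable_int If.
  apply: (measurable_comp _ _ mf) => //.
    by move=> _ [q _ <-]; rewrite /= in_itv/= andbT divr_ge0 ?sqr_ge0.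
  by apply: measurable_funM => //; exact: measurable_funX.
under eq_integral do rewrite /= normr_id.
exact: integral_comp_halfsq_lty d0 fM If.
Qed.

Lemma phi_ge0 {R : realType} (z : R) : 0 <= phi z.
Proof. exact: normal_pdf_ge0. Qed.

Lemma sqrt2pi_ge1 {R : realType} : 1 <= Num.sqrt (2 * pi) :> R.
Proof.
rewrite -[leLHS]sqrtr1 ler_sqrt; have := pi_ge2 R; lra.
Qed.

Lemma phi_le1 {R : realType} (z : R) : phi z <= 1.
Proof.
have := phi_gauss z; have := gauss_le1 z; have := phi_ge0 z.
have := @sqrt2pi_ge1 R; nra.
Qed.

Lemma Phi_ge0_le1 {R : realType} (z : R) : 0 <= Phi z <= 1.
Proof.
have s0 : 0 < Num.sqrt (2 * pi) :> R by exact: lt_le_trans (@sqrt2pi_ge1 R).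
have E := integral_gauss_Phi z; have E1 := @integral_gauss R.
have i0 : 0 <= \int[lebesgue_measure]_(q in `]-oo, z]) gauss q.
  by apply: Rintegral_ge0 => q _; exact: gauss_ge0.
have i1 : \int[lebesgue_measure]_(q in `]-oo, z]) gauss q <=
    \int[lebesgue_measure]_q gauss q.
  apply: Rintegral_subset_le => //; first exact: integrable_gauss.
  by move=> q _; exact: gauss_ge0.
apply/andP; split; first by rewrite -(pmulr_rge0 _ s0) -E.
by rewrite -(ler_pM2l s0) -E mulr1 -E1.
Qed.

(** * Error bounds and uniformity *)

Section expansion_errors.
Context {R : realType}.
Local Notation mu := (@lebesgue_measure R).
Implicit Types (f g : R -> R) (h c M z : R).

Let cross_le (a b u v : R) : 0 <= a -> 0 <= b -> 0 <= u -> 0 <= v ->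
  u * a + v * b <= (a + b) * (u + v).
Proof. by move=> *; nra. Qed.

Definition ray_const f M : R :=
  \int[mu]_q (q ^+ 2 * gauss q) + \int[mu]_q f (q ^+ 2 / 2) + M ^+ 3.

Definition cut_lipschitz (rho delta : R) : R :=
  delta^-1 + (Num.sqrt (1 - rho ^+ 2))^-1 +
  2 / (Num.sqrt (1 - rho ^+ 2) ^+ 2 * delta).

Definition cut_const f M (rho delta : R) : R :=
  delta^-1 * \int[mu]_(t in `[0, +oo[) f t +
  cut_lipschitz rho delta * (M + \int[mu]_(t in `[0, +oo[) (t * expR (- t))) +
  (Num.sqrt (1 - rho ^+ 2))^-1 * M ^+ 4.

(* Below, [g] is the survival ratio at a fixed x, [c] is |chi x| and [f] is
   |Theta|: all the bounds are explicit in h and c, hence uniform in x. *)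
Section fixed_ratio.
Variables (c M : R) (g f : R -> R).
Hypotheses (c0 : 0 <= c) (M0 : 0 <= M) (mg : measurable_fun [set: R] g).
Hypotheses (If : mu.-integrable `[0, +oo[ (EFin \o f))
  (Ifq : mu.-integrable setT (EFin \o (fun q => f (q ^+ 2 / 2))))
  (f0 : forall t, 0 <= t -> 0 <= f t)
  (gf : forall t, 0 <= t -> `|g t - expR (- t)| <= c * f t).
Local Notation ray h := (fun q => sec_angle_deriv (h * q) * g (q ^+ 2 / 2)).

Let gauss_moment_ge0 : 0 <= \int[mu]_q (q ^+ 2 * gauss q).
Proof. by apply: Rintegral_ge0 => q _; rewrite mulr_ge0 ?sqr_ge0 ?gauss_ge0. Qed.

Let fq_ge0 : 0 <= \int[mu]_q f (q ^+ 2 / 2).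
Proof. by apply: Rintegral_ge0 => q _; rewrite f0// divr_ge0 ?sqr_ge0. Qed.

Let exp_moment_ge0 : 0 <= \int[mu]_(t in `[0, +oo[) (t * expR (- t)).
Proof.
apply: Rintegral_ge0 => t; rewrite /= in_itv/= andbT => t0.
by rewrite mulr_ge0// expR_ge0.
Qed.

Let f_ge0 : 0 <= \int[mu]_(t in `[0, +oo[) f t.
Proof. by apply: Rintegral_ge0 => t; rewrite /= in_itv/= andbT; exact: f0. Qed.

Let mgq : measurable_fun [set: R] (fun q => g (q ^+ 2 / 2)).
Proof.
apply: (measurableT_comp mg).
by apply: measurable_funM => //; exact: measurable_funX.
Qed.

Lemma ray_const_ge0 : 0 <= ray_const f M.
Proof. exact: (addr_ge0 (addr_ge0 gauss_moment_ge0 fq_ge0) (exprn_ge0 _ M0)). Qed.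

Lemma line_error h : mu.-integrable setT (EFin \o ray h) /\
  `|\int[mu]_q ray h q - Num.sqrt (2 * pi)| <= ray_const f M * (h ^+ 2 + c).
Proof.
have [iT eT] := ray_integral_estimate h c0 measurableT mgq Ifq f0 gf.
split => //; rewrite integral_gauss in eT; apply: le_trans eT _.
apply: le_trans (cross_le gauss_moment_ge0 fq_ge0 (sqr_ge0 h) c0) _.
by rewrite ler_wpM2r ?addr_ge0 ?sqr_ge0// lerDl exprn_ge0.
Qed.

(** Besides the error of the integrand there is the error q0 - z = O(h^2) of the
    end point, where the Gaussian is at most 1. *)
Lemma ray_error h z : `|z| <= M ->
  `|\int[mu]_(q in `]-oo, ray_coord h z]) ray h q - Num.sqrt (2 * pi) * Phi z|
    <= ray_const f M * (h ^+ 2 + c).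
Proof.
move=> zM; rewrite -integral_gauss_Phi.
have [_ eI] := ray_integral_estimate h c0
  (measurable_itv `]-oo, ray_coord h z]) mgq Ifq f0 gf.
have eg : `|\int[mu]_(q in `]-oo, ray_coord h z]) gauss q -
    \int[mu]_(q in `]-oo, z]) gauss q| <= h ^+ 2 * M ^+ 3.
  apply: le_trans (Rintegral_gauss_lipschitz _ _) _.
  apply: le_trans (ray_coord_near h z) _.
  by rewrite ler_wpM2l ?sqr_ge0// lerXn2r ?nnegrE.
apply: le_trans (ler_distD (\int[mu]_(q in `]-oo, ray_coord h z]) gauss q) _ _) _.
apply: le_trans (lerD eI eg) _.
rewrite [ray_const f M * _]mulrDl; apply: lerD.
  exact: cross_le gauss_moment_ge0 fq_ge0 (sqr_ge0 h) c0.
by rewrite mulrC ler_wpM2l ?exprn_ge0// lerDl.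
Qed.

Section cut_error.
Variables (rho delta : R).
Hypotheses (rho0 : 0 <= rho) (rho1 : rho < 1) (delta0 : 0 < delta).
Local Notation sg := (Num.sqrt (1 - rho ^+ 2)).

Let sg_gt0 : 0 < sg.
Proof. by rewrite sqrtr_gt0 subr_gt0 expr_lt1. Qed.

Let sg_le1 : sg <= 1.
Proof. by rewrite -[leRHS]sqrtr1 ler_sqrt// gerBl sqr_ge0. Qed.

Let inv_ge0 : 0 <= delta^-1 /\ 0 <= sg^-1.
Proof. by rewrite !invr_ge0 !ltW. Qed.

Let cut_lipschitz_ge0 : 0 <= cut_lipschitz rho delta.
Proof.
have [d1 s1] := inv_ge0.
by rewrite !addr_ge0// divr_ge0 ?mulr_ge0 ?sqr_ge0 ?(ltW delta0).
Qed.

Lemma cut_const_ge0 : 0 <= cut_const f M rho delta.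
Proof.
have [d1 s1] := inv_ge0.
by rewrite !addr_ge0// mulr_ge0// ?exprn_ge0// addr_ge0.
Qed.

(** All errors are of first order: eta - rho is of order h, while the lower end
    point differs from z^2 / 2 by O(h^2) only. *)
Lemma cut_error h z : 0 <= h -> h <= 1 -> `|z| <= M ->
  let eta := rho + sg * (h * z) in
  let s0 := ray_coord h z ^+ 2 / 2 in
  let cut s := acos_kernel eta (1 + h ^+ 2 * s) * g s in
  delta ^+ 2 + eta ^+ 2 <= 1 ->
  mu.-integrable `[s0, +oo[ (EFin \o cut) /\
  (`|eta * \int[mu]_(s in `[s0, +oo[) cut s -
    Num.sqrt (2 * pi) * (rho * phi z / sg)| <= cut_const f M rho delta * (h + c)).
Proof.
move=> h0 h1 zM eta s0 cut de; have [d1 s1] := inv_ge0.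
have s00 : 0 <= s0 by rewrite divr_ge0 ?sqr_ge0.
have [iC eC] := cut_integral_estimate h delta0 rho0 rho1 de c0 s00 mg If f0 gf.
split => //; rewrite -/(cut_lipschitz rho delta) -/cut in eC.
set K := \int[mu]_(s in _) cut s in eC *.
have -> : Num.sqrt (2 * pi) * (rho * phi z / sg) = rho / sg * gauss z.
  by rewrite phi_gauss; ring.
have z40 : 0 <= z ^+ 4 by rewrite -[4%N]/(2 * 2)%N exprM sqr_ge0.
have hh : h ^+ 2 <= h by rewrite expr2 ler_piMl.
have z4 : h ^+ 2 * z ^+ 4 <= h * M ^+ 4.
  apply: ler_pM => //; first exact: sqr_ge0.
  by rewrite -[z ^+ 4]ger0_norm// normrX lerXn2r ?nnegrE.
have lip : `|rho / sg * expR (- s0) - rho / sg * gauss z| <= sg^-1 * (h * M ^+ 4).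
  rewrite -mulrBr normrM ger0_norm ?divr_ge0 ?(ltW sg_gt0)//.
  apply: ler_pM => //; first by rewrite divr_ge0 ?(ltW sg_gt0).
    by rewrite -[leRHS]mul1r ler_wpM2r// ltW.
  apply: le_trans (expRN_lipschitz s00 _) _; first by rewrite divr_ge0 ?sqr_ge0.
  exact: le_trans (ray_coord_sqr_near h z) z4.
have etarho : `|eta - rho| <= h * M.
  rewrite /eta addrAC subrr add0r normrM (gtr0_norm sg_gt0) -[leRHS]mul1r.
  by rewrite ler_pM// ?(ltW sg_gt0)// normrM (ger0_norm h0) ler_wpM2l.
apply: le_trans (ler_distD (rho / sg * expR (- s0)) _ _) _.
apply: le_trans (lerD eC lip) _.
rewrite /cut_const [leRHS]mulrDl; apply: lerD; last first.
  by rewrite mulrA -mulrA mulrCA mulrC ler_wpM2l ?mulr_ge0 ?exprn_ge0// lerDl.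
rewrite [leRHS]mulrDl; apply: lerD.
  rewrite [c * _]mulrC mulrA ler_wpM2l ?mulr_ge0// lerDr//.
rewrite -mulrA ler_wpM2l//.
apply: (@le_trans _ _ ((M + \int[mu]_(t in `[0, +oo[) (t * expR (- t))) * h)).
  by rewrite mulrDl lerD// ?(mulrC M)// mulrC ler_wpM2l.
by rewrite ler_wpM2l ?addr_ge0// lerDl.
Qed.

End cut_error.
End fixed_ratio.
End expansion_errors.

Section uniform_expansion.
Context {d : measure_display} {T : measurableType d} {R : realType}.
Variable P : probability T R.
Local Notation mu := (@lebesgue_measure R).
Variables (X Y : {RV P >-> R}) (rho : R) (H psi chi Theta : R -> R).
Hypotheses (rho_ge0 : 0 <= rho) (rho_lt1 : rho < 1)
  (XY_elliptical : standard_elliptical X Y rho H)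
  (survival_gt0 : forall x, 0 < survival H x)
  (psi_gt0 : forall x, 0 < psi x)
  (H_rate : \forall x \near +oo, forall t, 0 <= t ->
     `| survival H (x + t * psi x) / survival H x - expR (- t) |
       <= chi x * Theta t)
  (chi_cvg0 : chi x @[x --> +oo] --> 0)
  (psi_cvg0 : psi x / x @[x --> +oo] --> 0)
  (Theta_bounded : [locally [bounded Theta t | t in `[0, +oo[]])
  (Theta_integrable :
     lebesgue_measure.-integrable `[0, +oo[ (EFin \o Theta)).
Local Notation sg := (Num.sqrt (1 - rho ^+ 2)).
Local Notation h := (fun x => Num.sqrt (psi x / x)).

Let sg_gt0 : 0 < sg.
Proof. by rewrite sqrtr_gt0 subr_gt0 expr_lt1. Qed.

Let sg_le1 : sg <= 1.
Proof. by rewrite -[leRHS]sqrtr1 ler_sqrt// gerBl sqr_ge0. Qed.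

(** For |z| <= M and small h, the slope eta stays away from 1, and the corner
    stays below the direction theta. *)
Lemma slope_bounds (M hx z : R) : 0 <= hx -> 0 <= M ->
  hx * M <= (1 - rho) / 2 -> hx * M <= sg -> `|z| <= M ->
  `|rho + sg * (hx * z)| <= (1 + rho) / 2 /\ rho * (hx * z) <= sg.
Proof.
move=> h0 M0 h1 h2 zM.
have hz : `|hx * z| <= hx * M by rewrite normrM (ger0_norm h0) ler_wpM2l.
have shz : `|sg * (hx * z)| <= hx * M.
  by rewrite normrM (gtr0_norm sg_gt0) -[leRHS]mul1r ler_pM// ltW.
split.
  apply: le_trans (ler_normD _ _) _; rewrite (ger0_norm rho_ge0); lra.
apply: le_trans (ler_norm _) _; rewrite normrM (ger0_norm rho_ge0).
apply: (@le_trans _ _ (1 * `|hx * z|)); first by rewrite ler_wpM2r// ltW.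
by rewrite mul1r (le_trans hz).
Qed.

(** The constants depend on M, rho and the integrals of |Theta| only.  Since
    |eta| <= r1 = (1 + rho) / 2 < 1 for all |z| <= M, the single
    delta = sqrt (1 - r1^2) serves for all z. *)
Lemma uniform_expansion (M : R) : 0 <= M ->
  exists C : R, \forall x \near +oo, [/\ 0 < x, h x <= 1 &
   forall z, `|z| <= M ->
   `|cond_prob P [set w | Y w <= x * (rho + sg * (h x * z))] [set w | X w > x]
     - (Phi z - h x * (rho * phi z / sg))| <= C * (h x ^+ 2 + `|chi x|)].
Proof.
move=> M0.
have [_ [Rad [U [indep [Rad0 cdfE _] unif XE YE]]]] := XY_elliptical.
pose s : R := Num.sqrt (2 * pi).
have s1 : 1 <= s := @sqrt2pi_ge1 R.
have s0 : 0 < s by exact: lt_le_trans s1.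
pose f t := `|Theta t|.
have f0 t : 0 <= t -> 0 <= f t by move=> _; exact: normr_ge0.
have If : mu.-integrable `[0, +oo[ (EFin \o f) := integrable_norm Theta_integrable.
have Ifq : mu.-integrable setT (EFin \o (fun q => f (q ^+ 2 / 2))).
  exact: integrable_comp_halfsq.
have [rge rlt] := (rho_ge0, rho_lt1).
pose r1 := (1 + rho) / 2.
have r1_ge0 : 0 <= r1 by rewrite divr_ge0// addr_ge0.
have r1_lt1 : r1 < 1 by rewrite /r1 addrC; have [_] := midf_lt rho_lt1.
have r11 : 0 < 1 - r1 ^+ 2 by rewrite subr_gt0 expr_lt1.
pose delta := Num.sqrt (1 - r1 ^+ 2).
have d0 : 0 < delta by rewrite sqrtr_gt0.
have dE : delta ^+ 2 = 1 - r1 ^+ 2 by rewrite sqr_sqrtr// ltW.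
have sgV0 : 0 <= sg^-1 by rewrite invr_ge0 ltW.
pose A := ray_const f M + cut_const f M rho delta.
have A1_ge0 := ray_const_ge0 M0 f0.
have A2_ge0 := cut_const_ge0 M0 f0 rho_ge0 rho_lt1 d0.
have A0 : 0 <= A by exact: addr_ge0.
pose B := 1 + sg^-1; have B0 : 0 <= B by exact: addr_ge0.
exists ((2 + B) * A * 2 / s).
(* [kap] makes h small enough for [slope_bounds], and [tau] makes the
   denominator at least s / 2. *)
have M10 : 0 < M + 1 by exact: ltr_wpDl.
pose kap := Num.min 1 (Num.min ((1 - rho) / 2 / (M + 1)) (sg / (M + 1))).
have kap0 : 0 < kap by rewrite !lt_min ltr01/= !divr_gt0// subr_gt0.
have A10 : 0 < A + 1 by exact: ltr_wpDl.
pose tau := s / 2 / (2 * (A + 1)).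
have tau0 : 0 < tau by rewrite !divr_gt0// mulr_gt0.
have mkt0 : 0 < Num.min (kap ^+ 2) tau by rewrite lt_min tau0 exprn_gt0.
have psi_small : \forall x \near +oo, `|psi x / x| <= Num.min (kap ^+ 2) tau.
  by move/cvgr0_norm_le: psi_cvg0; exact.
have chi_small : \forall x \near +oo, `|chi x| <= tau.
  by move/cvgr0_norm_le: chi_cvg0; exact.
near=> x.
have x0 : 0 < x by near: x; exact: nbhs_pinfty_gt.
have rate : forall t, 0 <= t ->
   `| survival H (x + t * psi x) / survival H x - expR (- t) | <= chi x * Theta t.
  by near: x.
have pxs : `|psi x / x| <= Num.min (kap ^+ 2) tau by near: x.
have cxs : `|chi x| <= tau by near: x.
set hx := h x.
have px0 : 0 < psi x / x by rewrite divr_gt0.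
have h0 : 0 < hx by rewrite sqrtr_gt0.
have hE : hx ^+ 2 = psi x / x by rewrite sqr_sqrtr// ltW.
rewrite (gtr0_norm px0) -hE le_min in pxs; case/andP: pxs => hkap htau.
have hk : hx <= kap by rewrite -ler_sqr ?nnegrE ?(ltW h0) ?(ltW kap0).
move: hk; rewrite !le_min !(ler_pdivlMr _ _ M10) => /and3P[h1 hr hs].
have hM : hx * M <= hx * (M + 1) by rewrite ler_wpM2l ?(ltW h0)// lerDl.
split => // z zM.
have [etar rhz] := slope_bounds (ltW h0) M0 (le_trans hM hr) (le_trans hM hs) zM.
rewrite -/r1 in etar.
set eta := rho + sg * (hx * z) in etar *.
have de : delta ^+ 2 + eta ^+ 2 <= 1.
  rewrite dE -[eta ^+ 2](real_normK (num_real _)) -addrA gerDl.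
  by rewrite addrC subr_le0 lerXn2r// nnegrE (le_trans _ etar).
have eta1 : `|eta| < 1 := le_lt_trans etar r1_lt1.
set c := `|chi x| in cxs *; have c0 : 0 <= c := normr_ge0 _.
pose g := survival_ratio H x hx.
have mg : measurable_fun [set: R] g by exact: (measurable_survival_ratio cdfE).
have gf t : 0 <= t -> `|g t - expR (- t)| <= c * f t.
  move=> t0; rewrite /g /survival_ratio hE.
  have -> : x * (1 + psi x / x * t) = x + t * psi x by field; rewrite gt_eqF.
  by apply: le_trans (rate t t0) _; rewrite -normrM ler_norm.
have [iT eT] := line_error c0 M0 mg Ifq f0 gf hx.
have eI := ray_error c0 M0 mg Ifq f0 gf hx zM.
have [iC eC] := cut_error c0 M0 mg If f0 gf rho_ge0 rho_lt1 d0 (ltW h0) h1 zM de.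
have hc0 : 0 <= hx ^+ 2 + c by rewrite addr_ge0 ?sqr_ge0.
have hc0' : 0 <= hx + c by rewrite addr_ge0 ?(ltW h0).
rewrite (cond_prob_formula rho_ge0 rho_lt1 indep unif Rad0 cdfE XE YE)//.
apply: (@quotient_estimate _ A B s hx c) => //; first exact: ltW.
- apply: (@le_trans _ _ (A * (tau + tau))); first by rewrite ler_wpM2l// lerD.
  rewrite (_ : s / 2 = (A + 1) * (tau + tau)).
    by rewrite ler_wpM2r ?lerDl// addr_ge0// ltW.
  by rewrite /tau; field; rewrite gt_eqF.
- by apply: le_trans eI _; rewrite ler_wpM2r// lerDl.
- by apply: le_trans eT _; rewrite ler_wpM2r// lerDl.
- by apply: le_trans eC _; rewrite ler_wpM2r// lerDr.
- have /andP[P0 P1] := Phi_ge0_le1 z.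
  apply: le_trans (ler_normB _ _) _; rewrite /B lerD// ?(ger0_norm P0)//.
  rewrite ger0_norm; last first.
    by rewrite mulr_ge0 ?(ltW h0)// divr_ge0 ?mulr_ge0 ?phi_ge0// ltW.
  rewrite mulrA -[leRHS]mul1r ler_wpM2r// mulr_ile1 ?mulr_ge0 ?(ltW h0)//.
  - exact: phi_ge0.
  - by rewrite mulr_ile1 ?phi_ge0 ?phi_le1// ltW.
Unshelve. all: by end_near. Qed.

End uniform_expansion.

Lemma compact_norm_le {R : realType} (K : set R) : compact K ->
  exists2 M : R, 0 <= M & forall z, K z -> `|z| <= M.
Proof.
move=> /compact_bounded [M [_ KM]]; exists (`|M| + 1); first exact: addr_ge0.
by move=> z Kz; apply: KM => //; rewrite ltr_pwDr// ler_norm.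
Qed.

(** The derivative of Phi is phi, so the shift k h of the argument adds k h phi z,
    which is the correction term up to O(h^2). *)
Lemma shifted_expansion {R : realType} (rho M hx z : R) :
  0 <= rho -> rho < 1 -> 0 <= hx -> hx <= 1 -> `|z| <= M ->
  let k := rho / Num.sqrt (1 - rho ^+ 2) in
  let z' := z + k * hx in
  `|z'| <= M + k /\
  `|Phi z' - hx * (rho * phi z' / Num.sqrt (1 - rho ^+ 2)) - Phi z| <=
    2 * (M + k) * k ^+ 2 * hx ^+ 2.
Proof.
move=> rho0 rho1 h0 h1 zM k z'.
set sg := Num.sqrt (1 - rho ^+ 2) in k z' *.
have sg0 : 0 < sg by rewrite sqrtr_gt0 subr_gt0 expr_lt1.
have k0 : 0 <= k by rewrite divr_ge0// ltW.
have kh : 0 <= k * hx by exact: mulr_ge0.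
have z'M : `|z'| <= M + k.
  by apply: le_trans (ler_normD _ _) _; rewrite lerD// ger0_norm// ler_piMr.
split => //.
have zM' : `|z| <= M + k by rewrite (le_trans zM)// lerDl.
have Mk0 : 0 <= M + k by rewrite (le_trans _ zM').
pose s : R := Num.sqrt (2 * pi).
have s1 : 1 <= s := @sqrt2pi_ge1 R.
have s0 : 0 < s by exact: lt_le_trans s1.
have zz' : z <= z' by rewrite lerDl.
have H1 := Rintegral_gauss_taylor zz' zM' z'M.
have H2 := gauss_lipschitz z'M zM'.
rewrite !integral_gauss_Phi -/s in H1.
have dz : z' - z = k * hx by rewrite /z'; ring.
rewrite !dz (ger0_norm kh) in H1 H2.
have sE : s * (Phi z' - hx * (rho * phi z' / sg) - Phi z) =
   (s * Phi z' - s * Phi z - k * hx * gauss z) - k * hx * (gauss z' - gauss z).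
  by rewrite !phi_gauss -/s /k; ring.
have H3 : `|s * (Phi z' - hx * (rho * phi z' / sg) - Phi z)| <=
    2 * (M + k) * k ^+ 2 * hx ^+ 2.
  rewrite sE; apply: le_trans (ler_normB _ _) _.
  have H4 : `|k * hx * (gauss z' - gauss z)| <= k * hx * ((M + k) * (k * hx)).
    by rewrite normrM (ger0_norm kh) ler_wpM2l.
  rewrite (_ : 2 * (M + k) * k ^+ 2 * hx ^+ 2 =
    (M + k) * (k * hx) ^+ 2 + k * hx * ((M + k) * (k * hx))); last by ring.
  exact: lerD.
by apply: le_trans H3; rewrite normrM (gtr0_norm s0) ler_peMl.
Qed.

Theorem theorem2 (R : realType) (d : measure_display) (T : measurableType d)
    (P : probability T R) (X Y : {RV P >-> R}) (rho : R) (H : R -> R)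
    (psi chi Theta : R -> R)
    (rho_ge0 : 0 <= rho) (rho_lt1 : rho < 1)
    (XY_elliptical : standard_elliptical X Y rho H)
    (H_rapid : rapidly_varying_tail (survival H))
    (psi_gt0 : forall x, 0 < psi x)
    (H_rate : \forall x \near +oo, forall t, 0 <= t ->
       `| survival H (x + t * psi x) / survival H x - expR (- t) |
         <= chi x * Theta t)
    (chi_cvg0 : chi x @[x --> +oo] --> 0)
    (psi_cvg0 : psi x / x @[x --> +oo] --> 0)
    (Theta_bounded : [locally [bounded Theta t | t in `[0, +oo[]])
    (Theta_integrable :
       lebesgue_measure.-integrable `[0, +oo[ (EFin \o Theta)) :
  bigO_locally_uniform
    (fun z x =>
       cond_prob P
         [set w | Y w <= rho * x
                    + z * Num.sqrt (1 - rho ^+ 2) * Num.sqrt (x * psi x)]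
         [set w | X w > x]
       - (Phi z
          - Num.sqrt (psi x / x) * (rho * phi z / Num.sqrt (1 - rho ^+ 2))))
    (error_rate chi psi)
  /\
  bigO_locally_uniform
    (fun z x =>
       cond_prob P
         [set w | Y w <= rho * x
                    + z * Num.sqrt (1 - rho ^+ 2) * Num.sqrt (x * psi x)
                    + rho * psi x]
         [set w | X w > x]
       - Phi z)
    (error_rate chi psi).
Proof.
have survival_gt0 : forall x, 0 < survival H x by case: H_rapid.
have main M (M0 : 0 <= M) := uniform_expansion rho_ge0 rho_lt1 XY_elliptical
  survival_gt0 psi_gt0 H_rate chi_cvg0 psi_cvg0 Theta_bounded Theta_integrable M0.
have sg0 : 0 < Num.sqrt (1 - rho ^+ 2) by rewrite sqrtr_gt0 subr_gt0 expr_lt1.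
have px0 x : 0 < x -> 0 <= psi x / x by move=> x0; rewrite divr_ge0// ltW.
have hE x : 0 < x -> Num.sqrt (psi x / x) ^+ 2 = psi x / x.
  by move=> /px0 ?; rewrite sqr_sqrtr.
have rateE x : 0 < x ->
    `|error_rate chi psi x| = Num.sqrt (psi x / x) ^+ 2 + `|chi x|.
  move=> x0; rewrite hE// /error_rate ger0_norm; first by rewrite addrC.
  by rewrite addr_ge0// px0.
have sqrtE x : 0 < x -> Num.sqrt (x * psi x) = x * Num.sqrt (psi x / x).
  move=> x0; rewrite -[X in _ = X * _](gtr0_norm x0) -sqrtr_sqr -sqrtrM ?sqr_ge0//.
  by congr Num.sqrt; field; rewrite gt_eqF.
split => K /compact_norm_le [M M0 KM].
  have [C HC] := main M M0; exists C; move: HC.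
  apply: filterS => x [x0 _ Hx] z /KM zM; have := Hx z zM.
  rewrite rateE// sqrtE//.
  set y := x * _; rewrite (_ : rho * x + _ = y)//.
  by rewrite /y; ring.
pose k := rho / Num.sqrt (1 - rho ^+ 2).
have k0 : 0 <= k by rewrite divr_ge0// ltW.
have Mk0 : 0 <= M + k by exact: addr_ge0.
have [C HC] := main (M + k) Mk0; exists (C + 2 * (M + k) * k ^+ 2); move: HC.
apply: filterS => x [x0 h1 Hx] z /KM zM.
have h0 : 0 <= Num.sqrt (psi x / x) by exact: sqrtr_ge0.
have [z'M eS] := shifted_expansion rho_ge0 rho_lt1 h0 h1 zM.
have e1 := Hx _ z'M; rewrite rateE// sqrtE//.
set y := x * _ in e1; rewrite (_ : rho * x + _ + _ = y); last first.
  have psE : psi x = x * Num.sqrt (psi x / x) ^+ 2.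
    by rewrite hE//; field; rewrite gt_eqF.
  rewrite [in rho * psi x]psE /y; move: (Num.sqrt (psi x / x)) => hx.
  by field; rewrite gt_eqF.
apply: le_trans (ler_distD _ _ _) _; apply: le_trans (lerD e1 eS) _.
rewrite [leRHS]mulrDl lerD2l -/k ler_wpM2l ?lerDl//.
by rewrite !mulr_ge0 ?sqr_ge0.
Qed.
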